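(* Let $(\mathfrak{d},\mathfrak{g})$ be a Manin pair, let $(D,\Omega+\Theta)$ be a 2-shifted symplectic Lie group integrating $(\mathfrak{d},\langle\cdot,\cdot\rangle)$, and let $(\mathcal{H},\Phi,\sigma+0)$ be a lagrangian morphism into $D$, with $\mathcal{H}\rightrightarrows N$. Then its corresponding Dirac structure $\mathbf{L}\subseteq\mathbb{T}N\times\mathfrak{d}$ satisfies the condition that the projection on the second factor restricts to a fibrewise isomorphism $$\mathbf{L}\cap(TN\times\mathfrak{d})\xrightarrow{\ \sim\ }\mathfrak{g}$$ if and only if $\Phi:(\mathcal{H},\sigma)\to(D,\mathbf{A}_{\mathfrak{g}})$ is a strong Dirac morphism (i.e., $\Phi$ is a multiplicative $D$-valued moment map).
   Context: Everything is real and $C^\infty$. For a Lie groupoid $\mathcal{H}\rightrightarrows N$: source $\mathtt{s}$, target $\mathtt{t}$, multiplication $\mathtt{m}$ (defined when $\mathtt{s}(g)=\mathtt{t}(h)$), unit $\epsilon$; $A_{\mathcal{H}}=\ker(T\mathtt{s})|_N$, anchor $\mathtt{a}_{\mathcal{H}}=T\mathtt{t}$, bracket by right-invariant vector fields (same for Lie groups). $u^r,u^l$ are right/left-invariant vector fields. Manin pair $(\mathfrak{d},\mathfrak{g})$: a quadratic Lie algebra $(\mathfrak{d},\langle\cdot,\cdot\rangle)$ with a lagrangian Lie subalgebra $\mathfrak{g}=\mathfrak{g}^\perp$. 2-shifted symplectic Lie group $(D,\Omega+\Theta)$: $\Omega\in\Omega^2(D\times D)$, whose pullbacks along $k\mapsto(1,k)$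 and $k\mapsto(k,1)$ vanish, and $\Theta\in\Omega^3(D)$, such that $\delta\Omega=0$, $\delta\Theta=\mathrm{pr}_1^*\Theta+\mathrm{pr}_2^*\Theta-\mathtt{m}^*\Theta=-d\Omega$, $d\Theta=0$, where $\delta\Omega=(k_2,k_3)^*\Omega-(k_1k_2,k_3)^*\Omega+(k_1,k_2k_3)^*\Omega-(k_1,k_2)^*\Omega$, and with $\langle u,v\rangle_\Omega=-\Omega_{(1,1)}((u,0),(0,v))+\Omega_{(1,1)}((0,u),(v,0))$ nondegenerate. It integrates $(\mathfrak{d},\langle\cdot,\cdot\rangle)$ if $\mathrm{Lie}(D)=\mathfrak{d}$ and $\langle\cdot,\cdot\rangle_\Omega=\langle\cdot,\cdot\rangle$. Lagrangian morphism $(\mathcal{H},\Phi,\sigma+0)$ into $D$: a Lie groupoid morphism $\Phi:\mathcal{H}\to D$ and $\sigma\in\Omega^2(\mathcal{H})$ with $\epsilon^*\sigma=0$, $\mathrm{pr}_1^*\sigma+\mathrm{pr}_2^*\sigma-\mathtt{m}^*\sigma=\Phi^*\Omega$, $d\sigma+\Phi^*\Theta=0$, $\dim\mathcal{H}-2\dim N=\frac12\dim D$, and $\ker(\sigma)_h\cap\ker(T\Phi)_h\cap\ker(T\mathtt{s})_h\cap\ker(T\mathtt{t})_h=\{0\}$ for all $h$. Its corresponding Dirac structure is $\mathbf{L}=(\mathtt{a}_{\mathcal{H}},\lambda_\sigma,\mathrm{Lie}(\Phi))(A_{\mathcal{H}})\subseteq\mathbb{T}N\times\mathfrak{d}$,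 with $\lambda_\sigma(u)=(i_u\sigma)|_{TN}$; here $\mathbb{T}N\times\mathfrak{d}$ has underlying bundle $TN\oplus T^*N\oplus(N\times\mathfrak{d})$ and $TN\times\mathfrak{d}$ denotes the subbundle $TN\oplus0\oplus(N\times\mathfrak{d})$. $\mathbf{A}_{\mathfrak{g}}\subset\mathbb{T}_\Theta D=TD\oplus T^*D$ ($\Theta$-twisted Courant bracket) is the Dirac structure $\mathbf{A}_{\mathfrak{g}}|_d=\{((u^r-v^l)|_d,\ \Omega|_{(1,d)}((0,\cdot),(u,0))-\Omega|_{(d,1)}((\cdot,0),(0,v))):u,v\in\mathfrak{g}\}$. $\Phi:(\mathcal{H},\sigma)\to(D,\mathbf{A}_{\mathfrak{g}})$ is a strong Dirac morphism if $\mathbf{A}_{\mathfrak{g}}|_{\Phi(h)}=\{(T\Phi(Z),\beta): Z\in T_h\mathcal{H},\ \beta\in T^*_{\Phi(h)}D,\ i_Z\sigma=\Phi^*\beta\}$ for all $h\in\mathcal{H}$, and $\ker(\sigma)\cap\ker(T\Phi)=0$. A multiplicative $D$-valued moment map is a Lie groupoid morphism $\Phi:\mathcal{H}\to D$ with $\sigma\in\Omega^2(\mathcal{H})$ such that $(\mathcal{H},\Phi,\sigma+0)$ is a lagrangian morphism into $(D,\Omega+\Theta)$ and $\Phi:(\mathcal{H},\sigma)\to(D,\mathbf{A}_{\mathfrak{g}})$ is a strong Dirac morphism. (A manifold $N$ with a Dirac structure $\mathbf{L}\subseteq\mathbb{T}N\times\mathfrak{d}$ satisfying the fibrewise isomorphism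 condition is called a quasi-Poisson $\mathfrak{g}$-manifold.) *)

(* Defs.v *)
From HB Require Import structures.
From mathcomp Require Import all_boot all_order all_algebra.
From mathcomp Require Import all_classical all_reals all_analysis.
Set Implicit Arguments.
Unset Strict Implicit.
Unset Printing Implicit Defensive.
Import Order.TTheory GRing.Theory Num.Theory.
Import numFieldNormedType.Exports.
Local Open Scope classical_set_scope.
Local Open Scope ring_scope.

Section Smooth.
Context {R : realType}.

Fixpoint iterD {V W : normedModType R} (vs : seq V) (f : V -> W) : V -> W :=
  if vs is v :: vs' then 'D_v (iterD vs' f) else f.

(* C^oo on the open set U: every iterated directional derivative exists and
   is differentiable (hence continuous) on U. *)
Definition smooth_on {V W : normedModType R} (U : set V) (f : V -> W) : Prop :=
  forall (vs : seq V) (x : V), U x -> differentiable (iterD vs f) x.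

End Smooth.

(* The atlas is indexed by the points: [chart p] is a chart around p, with
   domain [dom p], image [cod p] and inverse [unchart p].  The maps are total;
   their values outside of [dom p], [cod p] are irrelevant.
   The Hausdorff axiom is not included: it is imposed separately. *)
Record manifold (R : realType) := Manifold {
  mcarrier :> topologicalType;
  mdim : nat;
  dom : mcarrier -> set mcarrier;
  cod : mcarrier -> set 'rV[R]_mdim;
  chart : mcarrier -> mcarrier -> 'rV[R]_mdim;
  unchart : mcarrier -> 'rV[R]_mdim -> mcarrier;
  mfd_second_countable : @second_countable mcarrier;
  open_dom : forall p, open (dom p);
  open_cod : forall p, open (cod p);
  mem_dom : forall p, dom p p;
  chart_cod : forall p q, dom p q -> cod p (chart p q);
  unchart_dom : forall p x, cod p x -> dom p (unchart p x);
  chartK : forall p q, dom p q -> unchart p (chart p q) = q;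
  unchartK : forall p x, cod p x -> chart p (unchart p x) = x;
  chart_continuous : forall p q, dom p q -> {for q, continuous (chart p)};
  unchart_continuous : forall p x, cod p x -> {for x, continuous (unchart p)};
  transition_smooth : forall p q,
    smooth_on [set x | cod p x /\ dom q (unchart p x)] (chart q \o unchart p) }.

Arguments dom {R m} _ _.
Arguments cod {R m} _ _.
Arguments chart {R m} _ _.
Arguments unchart {R m} _ _.

Section ProductManifold.
Context {R : realType}.

Lemma mx_continuous (T : topologicalType) m n (f : T -> 'M[R]_(m, n)) (x : T) :
  (forall i j, {for x, continuous (fun t => f t i j)}) ->
  {for x, continuous f}.
Proof.
move=> fc A [P Pn sPA].
have : \forall t \near x, forall i j, P i j (f t i j).
  by apply: filter_forall => i; apply: filter_forall => j; exact: fc.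
by apply: filterS => t Pt; exact: sPA.
Qed.

Lemma row_mx_continuous (T : topologicalType) a b (f : T -> 'rV[R]_a)
    (g : T -> 'rV[R]_b) (x : T) :
  {for x, continuous f} -> {for x, continuous g} ->
  {for x, continuous (fun t => row_mx (f t) (g t))}.
Proof.
move=> fc gc; apply: mx_continuous => i j.
case: (fintype.splitP j) => k jk.
  rewrite (_ : (fun t => _) = (fun M : 'rV[R]_a => M i k) \o f).
    by apply: continuous_comp => //; exact: coord_continuous.
  by apply/funext => t /=; rewrite -(row_mxEl (f t) (g t)); congr (row_mx _ _ _); exact: val_inj.
rewrite (_ : (fun t => _) = (fun M : 'rV[R]_b => M i k) \o g).
  by apply: continuous_comp => //; exact: coord_continuous.
by apply/funext => t /=; rewrite -(row_mxEr (f t) (g t)); congr (row_mx _ _ _); exact: val_inj.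
Qed.

Lemma near_eq_diff (V W : normedModType R) (f g : V -> W) (a : V) :
  (\near a, f a = g a) -> differentiable f a ->
  differentiable g a /\ 'd g a = 'd f a :> (V -> W).
Proof.
move=> fg df.
have ga : f a = g a by exact: nbhs_singleton fg.
have fg0 : \forall h \near 0, f (h + a) = g (h + a).
  by move: fg; rewrite (near_shift 0) subr0.
have gE : g \o shift a = cst (g a) + 'd f a +o_ 0 id.
  apply/eqaddoP => e e0.
  have /eqaddoP/(_ e e0) He := diff_locally df.
  apply: filterS2 fg0 He => h fgh; rewrite !fctE /= fgh ga; exact.
have dE : 'd g a = 'd f a :> (V -> W).
  by apply: diff_unique => //; exact: diff_continuous.
by split=> //; apply/diff_locallyP; rewrite dE; split => //; exact: diff_continuous.
Qed.

Definition row_pair a b (p : 'rV[R]_a * 'rV[R]_b) : 'rV[R]_(a + b) :=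
  row_mx p.1 p.2.

Fact row_pair_linear a b : linear (@row_pair a b).
Proof. by move=> k p q; rewrite /row_pair /= scale_row_mx add_row_mx. Qed.

HB.instance Definition _ a b := GRing.isLinear.Build R
  ('rV[R]_a * 'rV[R]_b)%type 'rV[R]_(a + b) *:%R (@row_pair a b)
  (@row_pair_linear a b).

Lemma row_pair_continuous a b : continuous (@row_pair a b).
Proof.
by move=> x; apply: row_mx_continuous; [exact: cvg_fst | exact: cvg_snd].
Qed.

Lemma diff_row_mx a b c d (f : 'rV[R]_a -> 'rV[R]_c) (g : 'rV[R]_b -> 'rV[R]_d)
    (x : 'rV[R]_(a + b)) :
  differentiable f (lsubmx x) -> differentiable g (rsubmx x) ->
  let F z := row_mx (f (lsubmx z)) (g (rsubmx z)) in
  differentiable F x /\ 'd F x =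
    (fun v => row_mx ('d f (lsubmx x) (lsubmx v)) ('d g (rsubmx x) (rsubmx v)))
    :> ('rV[R]_(a + b) -> 'rV[R]_(c + d)).
Proof.
move=> df dg F.
have dl := @differentiable_lsubmx R 1 a b x.
have dr := @differentiable_rsubmx R 1 a b x.
have dfl := differentiable_comp dl df.
have dgr := differentiable_comp dr dg.
have dp := differentiable_pair dfl dgr.
have drow : differentiable (@row_pair c d) (f (lsubmx x), g (rsubmx x)).
  by apply: linear_differentiable; exact: row_pair_continuous.
split; first exact: (differentiable_comp dp drow).
rewrite [LHS](diff_comp dp drow) diff_lin; last exact: row_pair_continuous.
rewrite diff_pair // diff_comp // diff_comp //.
by rewrite !diff_lin //; [exact: continuous_rsubmx | exact: continuous_lsubmx].
Qed.

Lemma smooth_on_row_mx a b c d (U : set 'rV[R]_a) (V : set 'rV[R]_b)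
    (f : 'rV[R]_a -> 'rV[R]_c) (g : 'rV[R]_b -> 'rV[R]_d) :
  open U -> open V -> smooth_on U f -> smooth_on V g ->
  smooth_on [set z : 'rV[R]_(a + b) | U (lsubmx z) /\ V (rsubmx z)]
    (fun z => row_mx (f (lsubmx z)) (g (rsubmx z))).
Proof.
move=> oU oV sf sg.
set UV := [set z | _]; set F := fun z => _.
have oUV : open UV.
  apply: openI.
    by apply: open_comp => // z _; exact: continuous_lsubmx.
  by apply: open_comp => // z _; exact: continuous_rsubmx.
pose G vs (z : 'rV[R]_(a + b)) :=
  row_mx (iterD (map lsubmx vs) f (lsubmx z))
         (iterD (map rsubmx vs) g (rsubmx z)).
have dG vs z : UV z -> differentiable (G vs) z.
  by move=> [Uz Vz]; exact: (diff_row_mx (sf _ _ Uz) (sg _ _ Vz)).1.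
have GE vs : forall z, UV z -> iterD vs F z = G vs z.
  elim: vs => [//|v vs IH] z UVz /=.
  have nE : \near z, iterD vs F z = G vs z.
    by apply: filterS (open_nbhs_nbhs (conj oUV UVz)) => y /IH.
  rewrite (near_eq_derive _ nE) deriveE; last exact: dG.
  have [Uz Vz] := UVz.
  rewrite (diff_row_mx (sf _ _ Uz) (sg _ _ Vz)).2.
  rewrite /G /= deriveE; last exact: sf.
  by rewrite deriveE //; exact: sg.
move=> vs z UVz.
have nE : \near z, G vs z = iterD vs F z.
  by apply: filterS (open_nbhs_nbhs (conj oUV UVz)) => y /GE.
exact: (near_eq_diff nE (dG _ _ UVz)).1.
Qed.

Lemma open_setX (S T : topologicalType) (A : set S) (B : set T) :
  open A -> open B -> open (A `*` B).
Proof.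
move=> oA oB; rewrite openE => -[x y] [/= Ax By].
by exists (A, B) => //=; split; exact: open_nbhs_nbhs.
Qed.

Lemma second_countable_prod (S T : topologicalType) :
  @second_countable S -> @second_countable T -> @second_countable (S * T)%type.
Proof.
move=> [B cB [oB bB]] [C cC [oC bC]].
exists ((fun p => p.1 `*` p.2) @` (B `*` C)).
  by apply: card_le_trans (card_image_le _ _) _; exact: countableX.
split.
  by move=> _ [[U V] [/= BU CV] <-]; apply: open_setX; [exact: oB | exact: oC].
move=> [x y] A [[P Q] [/= Px Qy] PQA].
have [U [BU Ux] UP] := bB x _ Px.
have [V [CV Vy] VQ] := bC y _ Qy.
exists (U `*` V); first by split => //; exists (U, V).
by move=> [z w] [/= Uz Vw]; apply: PQA; split; [exact: UP | exact: VQ].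
Qed.

Variables M N : manifold R.

Definition mprod_dom (p : M * N) : set (M * N) := dom p.1 `*` dom p.2.
Definition mprod_cod (p : M * N) : set 'rV[R]_(mdim M + mdim N) :=
  [set z | cod p.1 (lsubmx z) /\ cod p.2 (rsubmx z)].
Definition mprod_chart (p q : M * N) : 'rV[R]_(mdim M + mdim N) :=
  row_mx (chart p.1 q.1) (chart p.2 q.2).
Definition mprod_unchart (p : M * N) (z : 'rV[R]_(mdim M + mdim N)) : M * N :=
  (unchart p.1 (lsubmx z), unchart p.2 (rsubmx z)).

Fact mprod_open_dom p : open (mprod_dom p).
Proof. by apply: open_setX; exact: open_dom. Qed.

Fact mprod_open_cod p : open (mprod_cod p).
Proof.
apply: openI.
  apply: (@open_comp _ _ lsubmx (cod p.1)); last exact: open_cod.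
  by move=> z _; exact: continuous_lsubmx.
apply: (@open_comp _ _ rsubmx (cod p.2)); last exact: open_cod.
by move=> z _; exact: continuous_rsubmx.
Qed.

Fact mprod_mem_dom p : mprod_dom p p.
Proof. by split; exact: mem_dom. Qed.

Fact mprod_chart_cod p q : mprod_dom p q -> mprod_cod p (mprod_chart p q).
Proof.
by move=> [? ?]; split; rewrite ?row_mxKl ?row_mxKr; exact: chart_cod.
Qed.

Fact mprod_unchart_dom p x : mprod_cod p x -> mprod_dom p (mprod_unchart p x).
Proof. by move=> [? ?]; split; exact: unchart_dom. Qed.

Fact mprod_chartK p q : mprod_dom p q -> mprod_unchart p (mprod_chart p q) = q.
Proof.
case: q => q1 q2 [? ?].
by rewrite /mprod_unchart /mprod_chart row_mxKl row_mxKr !chartK.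
Qed.

Fact mprod_unchartK p x : mprod_cod p x -> mprod_chart p (mprod_unchart p x) = x.
Proof. by move=> [? ?]; rewrite /mprod_chart /= !unchartK // hsubmxK. Qed.

Fact mprod_chart_continuous p q : mprod_dom p q -> {for q, continuous (mprod_chart p)}.
Proof.
move=> [dp1 dp2]; apply: row_mx_continuous.
  by apply: continuous_comp; [exact: cvg_fst | exact: chart_continuous].
by apply: continuous_comp; [exact: cvg_snd | exact: chart_continuous].
Qed.

Fact mprod_unchart_continuous p x :
  mprod_cod p x -> {for x, continuous (mprod_unchart p)}.
Proof.
move=> [c1 c2].
have l := continuous_comp (@continuous_lsubmx R 1 _ _ x)
  (unchart_continuous c1).
have r := continuous_comp (@continuous_rsubmx R 1 _ _ x)
  (unchart_continuous c2).
exact: (cvg_pair l r).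
Qed.

Lemma open_overlap (P : manifold R) (p q : P) :
  open [set x | cod p x /\ dom q (unchart p x)].
Proof.
rewrite openE => x [cx dx].
have n1 : nbhs x (cod p) by apply: open_nbhs_nbhs; split => //; exact: open_cod.
have n2 : nbhs x (unchart p @^-1` dom q).
  apply: unchart_continuous => //.
  by apply: open_nbhs_nbhs; split => //; exact: open_dom.
exact: filterI.
Qed.

Fact mprod_transition_smooth p q :
  smooth_on [set x | mprod_cod p x /\ mprod_dom q (mprod_unchart p x)]
            (mprod_chart q \o mprod_unchart p).
Proof.
have := smooth_on_row_mx (@open_overlap M p.1 q.1)
  (@open_overlap N p.2 q.2) (@transition_smooth _ M p.1 q.1)
  (@transition_smooth _ N p.2 q.2).
by move=> H vs x [[c1 c2] [d1 d2]]; apply: (H vs x); split; split.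
Qed.

Definition mprod : manifold R := @Manifold R (M * N)%type (mdim M + mdim N)
  mprod_dom mprod_cod mprod_chart mprod_unchart
  (second_countable_prod (@mfd_second_countable _ M) (@mfd_second_countable _ N))
  mprod_open_dom mprod_open_cod mprod_mem_dom mprod_chart_cod mprod_unchart_dom
  mprod_chartK mprod_unchartK mprod_chart_continuous mprod_unchart_continuous
  mprod_transition_smooth.

End ProductManifold.

Section Calculus.
Context {R : realType}.
Implicit Types M N : manifold R.

(* T_pM for every p, read in the preferred chart [chart p] around p. *)
Local Notation tvec M := 'rV[R]_(mdim M).

(* The tangent map at x of [unchart p] : cod p -> M. *)
Definition tcoord M (p : M) (x : 'rV[R]_(mdim M)) : tvec M -> tvec M :=
  'd (chart (unchart p x) \o unchart p) x.

Definition smooth_map M N (f : M -> N) : Prop :=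
  continuous f /\
  forall p, smooth_on [set x | cod p x /\ dom (f p) (f (unchart p x))]
              (chart (f p) \o f \o unchart p).

Definition tmap M N (f : M -> N) (p : M) : {linear tvec M -> tvec N} :=
  'd (chart (f p) \o f \o unchart p) (chart p p).

Definition embedding M N (f : M -> N) : Prop :=
  [/\ smooth_map f, injective f,
      forall p, injective (tmap f p)
    & forall U : set M, open U -> exists2 V : set N, open V & U = f @^-1` V].

Definition submersion M N (f : M -> N) : Prop :=
  smooth_map f /\ forall p (w : tvec N), exists v, tmap f p v = w.

(* Fields of k-linear forms; [is_form] singles out the differential forms. *)
Definition kform M (k : nat) : Type := M -> ('I_k -> tvec M) -> R.

Definition chart_form M k (omega : kform M k) (p : M) (x : 'rV[R]_(mdim M))
    (v : 'I_k -> tvec M) : R :=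
  omega (unchart p x) (fun i => tcoord p x (v i)).

Record is_form M k (omega : kform M k) : Prop := IsForm {
  form_linear : forall p (v : 'I_k -> tvec M) i a u w,
    omega p (dfwith v i (a *: u + w)) =
    a * omega p (dfwith v i u) + omega p (dfwith v i w);
  form_alternating : forall p (v : 'I_k -> tvec M) i j,
    i != j -> v i = v j -> omega p v = 0;
  form_smooth : forall p v,
    smooth_on (cod p) (fun x => chart_form omega p x v) }.

Definition pullback M N (f : M -> N) k (omega : kform N k) : kform M k :=
  fun p v => omega (f p) (fun i => tmap f p (v i)).

Definition ext_d M k (omega : kform M k) : kform M k.+1 :=
  fun p v => \sum_(i < k.+1) (-1) ^+ i *
    'D_(v i) (fun x => chart_form omega p x (fun j => v (lift i j)))
      (chart p p).

Definition ev2 M (omega : kform M 2) (p : M) (u v : tvec M) : R :=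
  omega p (tnth [tuple u; v]).

Definition ker_form M (omega : kform M 2) (p : M) : set (tvec M) :=
  [set u | forall w, ev2 omega p u w = 0].

Definition ker_tmap M N (f : M -> N) (p : M) : set (tvec M) :=
  [set u | tmap f p u = 0].

(* The coordinate expression in [chart p] of a vector field X, where X q belongs
   to T_qM and is given in the chart [chart q]. *)
Definition chart_field M (X : M -> tvec M) (p : M) (x : 'rV[R]_(mdim M)) :
    'rV[R]_(mdim M) :=
  'd (chart p \o unchart (unchart p x))
     (chart (unchart p x) (unchart p x)) (X (unchart p x)).

Definition field_bracket M (X Y : M -> tvec M) : M -> tvec M :=
  fun p => 'D_(X p) (chart_field Y p) (chart p p)
           - 'D_(Y p) (chart_field X p) (chart p p).

Definition cotvec M : Type := 'Hom(tvec M, R^o).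

End Calculus.

Record lie_group (R : realType) := LieGroup {
  lmfd :> manifold R;
  lie_hausdorff : hausdorff_space lmfd;
  lmul : lmfd -> lmfd -> lmfd;
  lone : lmfd;
  linv : lmfd -> lmfd;
  lmulA : associative lmul;
  lmul1l : left_id lone lmul;
  lmulVl : left_inverse lone linv lmul;
  lmul_smooth : smooth_map (fun k : mprod lmfd lmfd => lmul k.1 k.2);
  linv_smooth : smooth_map linv }.

Section LieAlgebra.
Context {R : realType} (D : lie_group R).

Definition rtrans (k : D) : D -> D := fun x => lmul x k.
Definition ltrans (k : D) : D -> D := fun x => lmul k x.

Definition rinv_field (u : 'rV[R]_(mdim D)) : D -> 'rV[R]_(mdim D) :=
  fun k => tmap (rtrans k) (lone D) u.
Definition linv_field (u : 'rV[R]_(mdim D)) : D -> 'rV[R]_(mdim D) :=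
  fun k => tmap (ltrans k) (lone D) u.

(* The underlying space of Lie(D) is T_1 D. *)
Definition lie_bracket (u v : 'rV[R]_(mdim D)) : 'rV[R]_(mdim D) :=
  field_bracket (rinv_field u) (rinv_field v) (lone D).

End LieAlgebra.

(* The composable pairs are presented by a manifold [gcomp] embedded in the
   product with image {(g, h) | src g = tgt h}; since [src] is a submersion such
   a manifold exists and is unique up to a unique diffeomorphism.  The
   multiplication is a total function, meaningful on composable pairs only. *)
Record lie_groupoid (R : realType) := LieGroupoid {
  garr : manifold R;
  gbase : manifold R;
  gbase_hausdorff : hausdorff_space gbase;
  gsrc : garr -> gbase;
  gtgt : garr -> gbase;
  gunit : gbase -> garr;
  gmul : garr -> garr -> garr;
  ginv : garr -> garr;
  gcomp : manifold R;
  gincl : gcomp -> mprod garr garr;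
  gsrc_submersion : submersion gsrc;
  gtgt_submersion : submersion gtgt;
  gunit_smooth : smooth_map gunit;
  ginv_smooth : smooth_map ginv;
  gincl_embedding : embedding gincl;
  gincl_range : range gincl = [set c | gsrc c.1 = gtgt c.2];
  gmul_smooth : smooth_map (fun c => gmul (gincl c).1 (gincl c).2);
  gsrc_mul : forall g h, gsrc g = gtgt h -> gsrc (gmul g h) = gsrc h;
  gtgt_mul : forall g h, gsrc g = gtgt h -> gtgt (gmul g h) = gtgt g;
  gmulA : forall g h k, gsrc g = gtgt h -> gsrc h = gtgt k ->
    gmul g (gmul h k) = gmul (gmul g h) k;
  gsrc_unit : cancel gunit gsrc;
  gtgt_unit : cancel gunit gtgt;
  gmul_unitl : forall g, gmul (gunit (gtgt g)) g = g;
  gmul_unitr : forall g, gmul g (gunit (gsrc g)) = g;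
  gsrc_inv : forall g, gsrc (ginv g) = gtgt g;
  gtgt_inv : forall g, gtgt (ginv g) = gsrc g;
  gmulVl : forall g, gmul (ginv g) g = gunit (gsrc g);
  gmulVr : forall g, gmul g (ginv g) = gunit (gtgt g) }.

Arguments gsrc {R} l _.
Arguments gtgt {R} l _.
Arguments gunit {R} l _.

Record groupoid_morphism (R : realType) (H : lie_groupoid R) (D : lie_group R)
    (Phi : garr H -> D) : Prop := GroupoidMorphism {
  gmor_smooth : smooth_map Phi;
  gmor_unit : forall x, Phi (gunit H x) = lone D;
  gmor_mul : forall g h, gsrc H g = gtgt H h ->
    Phi (gmul g h) = lmul (Phi g) (Phi h) }.

Record quadratic_lie_algebra (R : realType) (V : vectType R) := QuadLie {
  qbr : V -> V -> V;
  qform : V -> V -> R;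
  qbr_linearl : forall a u v w, qbr (a *: u + v) w = a *: qbr u w + qbr v w;
  qbr_linearr : forall a u v w, qbr w (a *: u + v) = a *: qbr w u + qbr w v;
  qbr_alternating : forall u, qbr u u = 0;
  qbr_jacobi : forall u v w,
    qbr u (qbr v w) + qbr v (qbr w u) + qbr w (qbr u v) = 0;
  qform_linear : forall a u v w,
    qform (a *: u + v) w = a * qform u w + qform v w;
  qform_sym : forall u v, qform u v = qform v u;
  qform_nondegenerate : forall u, (forall v, qform u v = 0) -> u = 0;
  qform_invariant : forall u v w, qform (qbr u v) w = qform u (qbr v w) }.

Definition manin_pair (R : realType) (V : vectType R)
    (q : quadratic_lie_algebra V) (g : {vspace V}) : Prop :=
  (forall u v, u \in g -> v \in g -> qbr q u v \in g) /\
  (forall u, u \in g <-> forall v, v \in g -> qform q u v = 0).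

Section Shifted.
Context {R : realType} (D : lie_group R).
Local Notation DD := (mprod D D).
Local Notation DDD := (mprod DD D).
Local Notation dd := 'rV[R]_(mdim D).

Variables (Omega : kform DD 2) (Theta : kform D 3).

Definition pairing (u v : dd) : R :=
  - ev2 Omega (lone D, lone D) (row_mx u 0) (row_mx 0 v)
  + ev2 Omega (lone D, lone D) (row_mx 0 u) (row_mx v 0).

(* A point of D x D x D is ((k1, k2), k3). *)
Definition delta_Omega : kform DDD 2 :=
  pullback (fun k : DDD => (k.1.2, k.2) : DD) Omega
  - pullback (fun k : DDD => (lmul k.1.1 k.1.2, k.2) : DD) Omega
  + pullback (fun k : DDD => (k.1.1, lmul k.1.2 k.2) : DD) Omega
  - pullback (fun k : DDD => (k.1.1, k.1.2) : DD) Omega.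

Definition delta_Theta : kform DD 3 :=
  pullback (fun k : DD => k.1) Theta + pullback (fun k : DD => k.2) Theta
  - pullback (fun k : DD => lmul k.1 k.2) Theta.

Record two_shifted_symplectic : Prop := TwoShiftedSymplectic {
  Omega_form : is_form Omega;
  Theta_form : is_form Theta;
  Omega_unitl : pullback (fun k : D => (lone D, k) : DD) Omega = 0;
  Omega_unitr : pullback (fun k : D => (k, lone D) : DD) Omega = 0;
  Omega_closed : delta_Omega = 0;
  Theta_transgression : delta_Theta = - ext_d Omega;
  Theta_closed : ext_d Theta = 0;
  pairing_nondegenerate : forall u, (forall v, pairing u v = 0) -> u = 0 }.

Definition integrates (q : quadratic_lie_algebra dd) : Prop :=
  (forall u v, lie_bracket u v = qbr q u v) /\
  (forall u v, pairing u v = qform q u v).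

Variables (H : lie_groupoid R) (Phi : garr H -> D) (sigma : kform (garr H) 2).
Local Notation N := (gbase H).
Local Notation comp1 := (fun c : gcomp H => (gincl c).1).
Local Notation comp2 := (fun c : gcomp H => (gincl c).2).
Local Notation compm := (fun c : gcomp H => gmul (gincl c).1 (gincl c).2).

Record lagrangian_morphism : Prop := LagrangianMorphism {
  lag_morphism : groupoid_morphism Phi;
  lag_form : is_form sigma;
  lag_unit : pullback (gunit H) sigma = 0;
  lag_multiplicative :
    pullback comp1 sigma + pullback comp2 sigma - pullback compm sigma
    = pullback (fun c => (Phi (comp1 c), Phi (comp2 c)) : DD) Omega;
  lag_closed : ext_d sigma + pullback Phi Theta = 0;
  lag_dim : (mdim (garr H))%:R - 2 * (mdim N)%:R = (mdim D)%:R / 2 :> R;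
  lag_nondegenerate : forall h,
    ker_form sigma h `&` ker_tmap Phi h `&` ker_tmap (gsrc H) h
      `&` ker_tmap (gtgt H) h = [set 0] }.

(* An element ((X, alpha), xi) of the fibre TN + T*N + Lie(D) at x. *)
Definition corresponding_dirac (x : N) :
    set ('rV[R]_(mdim N) * cotvec N * dd) :=
  [set e : 'rV[R]_(mdim N) * cotvec N * dd | exists u : 'rV[R]_(mdim (garr H)),
    [/\ ker_tmap (gsrc H) (gunit H x) u,
        e.1.1 = tmap (gtgt H) (gunit H x) u,
        forall w, e.1.2 w = ev2 sigma (gunit H x) u (tmap (gunit H) x w)
      & e.2 = tmap Phi (gunit H x) u]].

Variable g : {vspace dd}.

Definition action_dirac (k : D) : set (dd * cotvec D) :=
  [set e : dd * cotvec D | exists u v, [/\ u \in g, v \in g,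
    e.1 = rinv_field u k - linv_field v k
  & forall w, e.2 w =
      ev2 Omega (lone D, k) (row_mx 0 w) (row_mx u 0)
      - ev2 Omega (k, lone D) (row_mx w 0) (row_mx 0 v)]].

End Shifted.

(* The projection to Lie(D) restricts to a bijection from the fibre at every x
   of L n (TN x Lie(D)) onto g; it is automatically linear. *)
Definition fibrewise_iso (R : realType) (N : manifold R) (V : vectType R)
    (L : forall x : N, set ('rV[R]_(mdim N) * cotvec N * V))
    (g : {vspace V}) : Prop :=
  forall x, set_bij (L x `&` [set e | e.1.2 = 0]) [set xi | xi \in g] snd.

Definition strong_dirac_morphism (R : realType) (M Q : manifold R)
    (f : M -> Q) (sigma : kform M 2)
    (A : forall q : Q, set ('rV[R]_(mdim Q) * cotvec Q)) : Prop :=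
  forall h,
    A (f h) = [set e : 'rV[R]_(mdim Q) * cotvec Q | exists Z : 'rV[R]_(mdim M),
      e.1 = tmap f h Z /\ forall w, ev2 sigma h Z w = e.2 (tmap f h w)] /\
    ker_form sigma h `&` ker_tmap f h = [set 0].

Definition multiplicative_moment_map (R : realType) (D : lie_group R)
    (Omega : kform (mprod D D) 2) (Theta : kform D 3)
    (g : {vspace 'rV[R]_(mdim D)}) (H : lie_groupoid R)
    (Phi : garr H -> D) (sigma : kform (garr H) 2) : Prop :=
  lagrangian_morphism Omega Theta Phi sigma /\
  strong_dirac_morphism Phi sigma (action_dirac Omega g).

(* Main.v *)
(* At an arrow h over x -> y, multiplicativity of sigma shows that the right
   translate X^r of X in the Lie algebroid at y satisfies
     i_{X^r} sigma = t^* (lambda_sigma X) + Phi^* Omega_{(1, Phi h)}((0, .), (u, 0)),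
   with u = Lie(Phi) X, and symmetrically for left translates.  So an X with
   lambda_sigma X = 0 and u in g puts the generator u of A_g in the forward image
   of the graph of sigma.  From delta Omega = 0, the map from d + d (with form
   <,> - <,>) to TD + T^*D that sends g + g onto A_g is an isometry, hence
   bijective, so A_g is maximal isotropic; the forward image is isotropic, and the
   two agree as soon as one contains the other.  If L is transverse to g in the
   stated sense, the dimension condition makes lambda_sigma onto T^*N, which forces
   ker sigma n ker T Phi into ker T s n ker T t, where it vanishes.  The converse is
   read off at the units.  Translating X to h needs the tangent space of the manifold
   of composable pairs: a tangent vector is realised by a curve obtained from metric
   regularity of submersions, and its lift through the embedding is differentiable
   because the embedding has injective differential. *)
Require Import Defs.
From HB Require Import structures.
From mathcomp Require Import all_boot all_order all_algebra.
From mathcomp Require Import all_classical all_reals all_analysis.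
From mathcomp Require Import zify ring lra.
Import Order.TTheory GRing.Theory Num.Theory.
Import numFieldNormedType.Exports.
Set Implicit Arguments.
Unset Strict Implicit.
Unset Printing Implicit Defensive.
Local Open Scope classical_set_scope.
Local Open Scope ring_scope.

(** * Differentials and metric regularity *)

Section RowVectors.
Context {R : realType}.

Lemma coord_le_norm m n (v : 'M[R]_(m, n)) i j : `|v i j| <= `|v|.
Proof.
rewrite [leRHS]/Num.norm /= mx_normrE.
by apply: (le_bigmax _ (fun ij : 'I_m * 'I_n => `|v ij.1 ij.2|) (i, j)).
Qed.

Lemma norm_le_coord m n (v : 'M[R]_(m, n)) c :
  0 <= c -> (forall i j, `|v i j| <= c) -> `|v| <= c.
Proof.
move=> c0 vc; rewrite [leLHS]/Num.norm /= mx_normrE.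
by apply/bigmax_leP; split=> // -[i j] _ /=.
Qed.

Lemma rV_linear_sum n (W : lmodType R) (f : {linear 'rV[R]_n -> W}) v :
  f v = \sum_i v 0 i *: f (delta_mx 0 i).
Proof. by rewrite {1}[v]row_sum_delta linear_sum; under eq_bigr do rewrite linearZ. Qed.

Lemma rV_linear_le n (W : normedModType R) (f : {linear 'rV[R]_n -> W}) e v :
  (forall i, `|f (delta_mx 0 i)| <= e) -> `|f v| <= n%:R * e * `|v|.
Proof.
move=> fe; rewrite rV_linear_sum.
apply: le_trans (ler_norm_sum _ _ _) _.
rewrite -mulrA mulr_natl -[n in _ *+ n]card_ord -sumr_const.
apply: ler_sum => i _; rewrite normrZ mulrC.
by apply: ler_pM => //; exact: coord_le_norm.
Qed.

Lemma rV_linear_bounded n (W : normedModType R) (f : {linear 'rV[R]_n -> W}) :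
  exists2 C, 0 < C & forall v, `|f v| <= C * `|v|.
Proof.
pose e := \sum_i `|f (delta_mx 0 i)|.
have e0 : 0 <= e by apply: sumr_ge0.
exists (n%:R * e + 1); first by rewrite ltr_wpDl // mulr_ge0.
move=> v; apply: (@le_trans _ _ (n%:R * e * `|v|)).
  apply: rV_linear_le => i; rewrite /e (bigD1 i) //= lerDl.
  by apply: sumr_ge0.
by rewrite ler_wpM2r // lerDl.
Qed.

Lemma rV_linear_continuous n (W : normedModType R) (f : {linear 'rV[R]_n -> W}) :
  continuous f.
Proof.
apply: bounded_linear_continuous; apply/linear_boundedP.
have [C C0 fC] := rV_linear_bounded f.
near=> r => v; apply: le_trans (fC v) _.
by rewrite ler_wpM2r //; near: r; exact: nbhs_pinfty_ge.
Unshelve. all: by end_near. Qed.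

Lemma differentiable_near (V W : normedModType R) (f : V -> W) x :
  differentiable f x ->
  forall e, 0 < e ->
  \forall y \near x, `|f y - f x - 'd f x (y - x)| <= e * `|y - x|.
Proof.
move=> df e e0.
have /eqaddoP/(_ e e0) := diff_locally df.
rewrite (near_shift 0 x) subr0; apply: filterS => h.
by rewrite /= !fctE /= addrK opprD addrA.
Qed.

Lemma near_differentiable (V W : normedModType R) (f : V -> W)
    (A : {linear V -> W}) (x : V) : continuous A ->
  (forall e : R, 0 < e ->
    \forall y \near x, `|f y - f x - A (y - x)| <= e * `|y - x|) ->
  differentiable f x /\ 'd f x = A :> (V -> W).
Proof.
move=> cA H.
have fE : f \o shift x = cst (f x) + A +o_ 0 id.
  apply/eqaddoP => e e0.
  have := H e e0; rewrite (near_shift 0) subr0; apply: filterS => h.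
  by rewrite /= !fctE /= addrK opprD addrA.
have dE : 'd f x = A :> (_ -> _) by apply: diff_unique.
by split=> //; apply/diff_locallyP; rewrite dE.
Qed.

End RowVectors.

(** * Mean value inequality and strict differentiability *)

Section StrictDifferentiability.
Context {R : realType}.

Definition rV_coord n (j : 'I_n) (v : 'rV[R]_n) : R := v 0 j.

Fact rV_coord_linear n (j : 'I_n) : linear (rV_coord j).
Proof. by move=> k u v; rewrite /rV_coord !mxE. Qed.

HB.instance Definition _ n (j : 'I_n) :=
  GRing.isLinear.Build R 'rV[R]_n R *:%R (rV_coord j) (rV_coord_linear j).

Lemma is_derive_line (V W : normedModType R) (f : V -> W) (x v : V) (t : R) :
  differentiable f (x + t *: v) ->
  is_derive t 1 (fun s : R => f (x + s *: v)) ('d f (x + t *: v) v).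
Proof.
move=> df.
have E : (fun h : R => h^-1 *: (((fun s => f (x + s *: v)) \o shift t) (h *: 1)
                                - f (x + t *: v))) =
         (fun h => h^-1 *: ((f \o shift (x + t *: v)) (h *: v) - f (x + t *: v))).
  apply/funext => h /=.
  by rewrite [h *: 1]mulr1 scalerDl addrCA.
apply: DeriveDef; first by rewrite /derivable E; exact: diff_derivable.
by rewrite /derive E -deriveE.
Qed.

(** The mean value theorem is available for real functions only, so it is applied to each coordinate
    of [f - A] along the segment. The norm of row vectors is the maximum of the coordinates, hence
    the same [c] serves for the whole vector. *)
Lemma mean_value_line n (V : normedModType R) (f : V -> 'rV[R]_n)
    (A : {linear V -> 'rV[R]_n}) (x v : V) (c : R) : continuous A ->
  (forall t : R, 0 <= t <= 1 -> differentiable f (x + t *: v)) ->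
  (forall t : R, 0 <= t <= 1 -> `|'d f (x + t *: v) v - A v| <= c) ->
  `|f (x + v) - f x - A v| <= c.
Proof.
move=> cA df fc.
have c0 : 0 <= c by apply: le_trans (fc 0 _); rewrite ?lexx ?ler01.
apply: norm_le_coord => // i j; rewrite ord1 {i}.
pose g := rV_coord j \o (f - (A : V -> 'rV[R]_n)).
have cj : continuous (rV_coord j) by exact: rV_linear_continuous.
have dA y : differentiable A y by exact: linear_differentiable.
have dB t : 0 <= t <= 1 -> differentiable (f - (A : V -> 'rV[R]_n)) (x + t *: v).
  by move=> t01; apply: differentiableB => //; exact: df.
have dg t : 0 <= t <= 1 -> differentiable g (x + t *: v).
  by move=> t01; apply: differentiable_comp; [exact: dB | exact: linear_differentiable].
have gE t : 0 <= t <= 1 ->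
    'd g (x + t *: v) v = ('d f (x + t *: v) v - A v) 0 j.
  move=> t01.
  have dc y : 'd (rV_coord j) y = rV_coord j :> (_ -> _) by exact: diff_lin.
  have dcA y : 'd A y = A :> (_ -> _) by exact: diff_lin.
  have dfA : 'd (f - (A : V -> 'rV[R]_n)) (x + t *: v) =
      'd f (x + t *: v) \- 'd A (x + t *: v) :> (_ -> _).
    by apply: diffB => //; exact: df.
  have dgc := @diff_comp _ _ _ _ _ (rV_coord j) _ (dB t t01)
    (linear_differentiable _ cj).
  rewrite -(dcA (x + t *: v)) -[RHS]/(rV_coord j (('d f (x + t *: v) \- 'd A (x + t *: v)) v)).
  by rewrite -dfA -(dc ((f - (A : V -> 'rV[R]_n)) (x + t *: v))) /g dgc.
(* The intermediate point depends on the coordinate [j], which is harmless because the bound [c] is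
   uniform in [t]. *)
have [t t01 gt] : exists2 t : R, t \in `[0, 1] &
    g (x + 1 *: v) - g (x + 0 *: v) = 'd g (x + t *: v) v * (1 - 0).
  apply: (@MVT_segment _ (fun s => g (x + s *: v)) (fun s => 'd g (x + s *: v) v)) => //.
    move=> s; rewrite in_itv /= => /andP[s0 s1].
    by apply: is_derive_line; apply: dg; rewrite !ltW.
  apply: derivable_within_continuous => s; rewrite in_itv /= => s01.
  by have [] := is_derive_line (dg s s01).
have {}t01 : 0 <= t <= 1 by rewrite in_itv in t01.
have -> : (f (x + v) - f x - A v) 0 j = 'd g (x + t *: v) v.
  rewrite -[RHS]mulr1 -[1 in RHS]subr0 -gt scale1r scale0r addr0.
  by rewrite /g /= /rV_coord !fctE !mxE linearD !mxE; ring.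
by rewrite gE //; apply: le_trans (coord_le_norm _ _ _) _; exact: fc.
Qed.

(** Continuity of the partial derivatives at [x0] keeps the differential close to the one at [x0] on
    a ball, and the mean value inequality is used on segments inside that ball. Both end points are
    free: this is what makes the map built in the metric regularity proof a contraction. *)
Lemma smooth_strictly_differentiable m n (U : set 'rV[R]_m)
    (f : 'rV[R]_m -> 'rV[R]_n) (x0 : 'rV[R]_m) (e : R) :
  open U -> U x0 -> smooth_on U f -> 0 < e ->
  exists2 d : R, 0 < d & forall x y, `|x - x0| < d -> `|y - x0| < d ->
    `|f y - f x - 'd f x0 (y - x)| <= e * `|y - x|.
Proof.
move=> oU Ux0 sf e0.
have df x : U x -> differentiable f x by exact: (sf [::]).
(* Each of the [m] partial derivatives may contribute [e']; dividing by [m.+1] instead of [m] covers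
   [m = 0]. *)
pose e' := e / m.+1%:R.
have e'0 : 0 < e' by rewrite divr_gt0.
have nU : \near x0, U x0 by exact: open_nbhs_nbhs.
have nD : \forall y \near x0,
    forall i, `|'D_(delta_mx 0 i) f y - 'D_(delta_mx 0 i) f x0| < e'.
  have := @filter_forall _ 'I_m (fun i y => `|'D_(delta_mx 0 i) f y - 'D_(delta_mx 0 i) f x0| < e') (nbhs x0) _; apply => i.
  have := differentiable_continuous (sf [:: delta_mx 0 i] x0 Ux0).
  move=> /cvgrPdist_lt /(_ e' e'0); apply: filterS => y /=.
  by rewrite distrC.
have /nbhs_normP[d /= d0 Hd] : \forall y \near x0, U y /\
    forall i, `|'D_(delta_mx 0 i) f y - 'D_(delta_mx 0 i) f x0| < e'.
  exact: filterI nU nD.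
exists d => // x y xd yd.
have seg t : 0 <= t <= 1 -> `|x + t *: (y - x) - x0| < d.
  move=> /andP[t0 t1].
  have -> : x + t *: (y - x) - x0 = (1 - t) *: (x - x0) + t *: (y - x0).
    by apply/rowP => i; rewrite !mxE; ring.
  apply: le_lt_trans (ler_normD _ _) _.
  rewrite !normrZ !ger0_norm ?subr_ge0 //.
  have [tx|tx] := leP `|x - x0| `|y - x0|; nra.
have Hseg t : 0 <= t <= 1 -> U (x + t *: (y - x)) /\
    forall i, `|'D_(delta_mx 0 i) f (x + t *: (y - x)) - 'D_(delta_mx 0 i) f x0| < e'.
  by move=> /seg t01; apply: Hd; rewrite /= distrC.
rewrite -[y in f y](subrKC x).
apply: mean_value_line; first exact: rV_linear_continuous.
  by move=> t /Hseg[] /df.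
move=> t /Hseg[Ut Dt].
have dE : `|('d f (x + t *: (y - x)) \- 'd f x0) (y - x)| <= m%:R * e' * `|y - x|.
  apply: rV_linear_le => i; have := ltW (Dt i).
  by rewrite (deriveE _ (df _ Ut)) (deriveE _ (df _ Ux0)).
apply: le_trans dE _.
rewrite ler_wpM2r // /e' mulrCA ger_pMr // ler_pdivrMr // mul1r.
by rewrite ler_nat.
Qed.

End StrictDifferentiability.

(** Completeness of the row vectors, required by the Banach fixed point theorem below. *)
HB.instance Definition _ (R : realType) m n :=
  Uniform_isComplete.Build 'M[R]_(m, n) cauchy_cvg.

(** * Metric regularity and differentiability of lifts *)

Section MetricRegularity.
Context {R : realType}.

Lemma rV_right_inverse m n (A : {linear 'rV[R]_m -> 'rV[R]_n}) :
  (forall w, exists v, A v = w) ->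
  exists M : 'M[R]_(n, m), forall w, A (w *m M) = w.
Proof.
move=> sA.
have [b bE] := choice (fun i => sA (delta_mx 0 i)).
exists (\matrix_(i < n) b i) => w.
rewrite mulmx_sum_row linear_sum [RHS]row_sum_delta.
by apply: eq_bigr => i _; rewrite linearZ /= rowK bE.
Qed.

(* With [M] a right inverse of the differential, [z |-> z + (y - f (x + z M))] is a
   contraction of the ball of radius [2 |y - f x|]. *)
Lemma smooth_metric_regularity m n (U : set 'rV[R]_m)
    (f : 'rV[R]_m -> 'rV[R]_n) (x0 : 'rV[R]_m) :
  open U -> U x0 -> smooth_on U f -> (forall w, exists v, 'd f x0 v = w) ->
  exists C d : R, [/\ 0 < C, 0 < d & forall x y,
    `|x - x0| < d -> `|y - f x0| < d ->
    exists2 x', f x' = y & `|x' - x| <= C * `|y - f x|].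
Proof.
move=> oU Ux0 sf sA.
have [M AM] := rV_right_inverse sA.
have [K K0 MK] := rV_linear_bounded (mulmxr M : {linear 'rV[R]_n -> 'rV[R]_m}).
have [L L0 AL] := rV_linear_bounded ('d f x0).
(* Since [M] expands norms by at most [K], an error rate of [1 / (2K)] for [f] gives the contraction
   factor [1/2]. *)
pose e : R := (2 * K)^-1.
have e0 : 0 < e by rewrite invr_gt0 mulr_gt0.
have [d0 d00 fd] := smooth_strictly_differentiable oU Ux0 sf e0.
(* With [d = d0 / c], a point [x] within [d] of [x0] moved by [z *m M], where the norm of [z] is at
   most [2 * (1 + L + e) * d], stays within [d0] of [x0], where the strict estimate holds. *)
pose c : R := 2 + 4 * K * (1 + L + e).
have KLe : 0 < K * (1 + L + e) by rewrite mulr_gt0 // !addr_gt0.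
have c0 : 0 < c by rewrite /c; lra.
pose d := d0 / c.
have dE : d0 = 2 * d + 4 * (K * (1 + L + e)) * d.
  by rewrite mulrA -mulrDl -[2 + _]/c /d mulrC divfK // gt_eqF.
have dpos : 0 < d by rewrite divr_gt0.
have Kd : 0 < K * (1 + L + e) * d by rewrite mulr_gt0.
exists (2 * K), d; split=> //; first by rewrite mulr_gt0.
move=> x y xd yd.
pose r := 2 * `|y - f x|.
have r0 : 0 <= r by rewrite mulr_ge0.
have xd0 : `|x - x0| < d0 by lra.
have x00 : `|x0 - x0| < d0 by rewrite subrr normr0.
have yfx : `|y - f x| <= (1 + L + e) * d.
  have -> : y - f x = (y - f x0) - (f x - f x0 - 'd f x0 (x - x0)) - 'd f x0 (x - x0).
    by apply/rowP => i; rewrite !mxE; ring.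
  apply: le_trans (ler_normB _ _) _.
  apply: le_trans (lerD (ler_normB _ _) (AL _)) _.
  have := fd x0 x x00 xd0.
  by have := normr_ge0 (x - x0); nra.
have in_ball z : `|z| <= r -> `|x + z *m M - x0| < d0.
  move=> zr; rewrite addrAC; apply: le_lt_trans (ler_normD _ _) _.
  have := MK z; rewrite /= => zK.
  have : K * `|z| <= K * (2 * ((1 + L + e) * d)).
    by rewrite ler_pM2l //; apply: le_trans zr _; rewrite /r; lra.
  by nra.
pose G z := z + (y - f (x + z *m M)).
have Glip z z' : `|z| <= r -> `|z'| <= r -> `|G z - G z'| <= 2^-1 * `|z - z'|.
  move=> zr z'r.
  have zzE : x + z *m M - (x + z' *m M) = (z - z') *m M.
    by rewrite opprD addrACA subrr add0r mulmxBl.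
  have -> : G z - G z' =
      - (f (x + z *m M) - f (x + z' *m M)
         - 'd f x0 ((x + z *m M) - (x + z' *m M))).
    rewrite zzE AM /G.
    by apply/rowP => i; rewrite !mxE; ring.
  rewrite normrN; apply: le_trans (fd _ _ (in_ball _ z'r) (in_ball _ zr)) _.
  rewrite zzE.
  apply: le_trans (_ : e * (K * `|z - z'|) <= _).
    by rewrite ler_pM2l //; exact: MK.
  by rewrite mulrA /e invfM divfK ?gt_eqF.
pose Ur := [set z : 'rV[R]_n | `|z| <= r].
have GU : {homo G : z / Ur z >-> Ur z}.
  move=> z zr; rewrite /Ur /= in zr *.
  have Ur0 : `|0 : 'rV[R]_n| <= r by rewrite normr0.
  have := Glip z 0 zr Ur0; rewrite subr0 {2}/G mul0mx addr0 add0r => H.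
  rewrite -[G z](subrK (y - f x)); apply: le_trans (ler_normD _ _) _.
  by rewrite /r in zr *; lra.
have ctrG : is_contraction (mkfun GU).
  exists (2^-1)%:nng; split; first by rewrite /= invf_lt1 // ltr1n.
  by move=> [z z'] [/= zr z'r]; exact: Glip.
have clUr : closed Ur.
  apply: (@closed_comp _ _ (fun z : 'rV[R]_n => `|z|) [set s | s <= r]).
    by move=> z _; exact: norm_continuous.
  exact: closed_le.
have Ur0 : Ur !=set0 by exists 0; rewrite /Ur /= normr0.
have [z zr zG] := @banach_fixed_point R 'rV[R]_n Ur (mkfun GU) ctrG clUr Ur0.
(* A fixed point of [G] is a [z] whose correction term [y - f (x + z *m M)] vanishes. *)
have {}zG : z = G z by exact: zG.
exists (x + z *m M).
  by apply/eqP; rewrite eq_sym -subr_eq0; apply/eqP/(addrI z); rewrite addr0 -[LHS]/(G z).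
rewrite addrAC subrr add0r; apply: le_trans (MK z) _.
by rewrite -mulrA mulrCA ler_pM2l.
Qed.

Lemma rV_left_inverse m n (A : {linear 'rV[R]_m -> 'rV[R]_n}) :
  injective A -> exists M : 'M[R]_(n, m), forall v, A v *m M = v.
Proof.
move=> iA; exists (pinvmx (lin1_mx A)) => v.
rewrite -mul_rV_lin1 -mulmxA mulmxVp ?mulmx1 //.
by apply: inj_row_free => w; rewrite mul_rV_lin1 -(linear0 A) => /iA.
Qed.

(** A left inverse of the injective differential of [i], applied to the differential of [i \o L], is
    the only candidate [B] for the differential of [L]. The estimate has two passes: continuity of
    [L] first gives a Lipschitz bound at [t], which then turns an error small relative to
    [L s - L t] into one small relative to [s - t]. *)
Lemma differentiable_lift (T : normedModType R) m n (i : 'rV[R]_m -> 'rV[R]_n)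
    (L : T -> 'rV[R]_m) (t : T) :
  differentiable i (L t) -> injective ('d i (L t)) ->
  {for t, continuous L} -> differentiable (i \o L) t ->
  differentiable L t.
Proof.
move=> di inj_i cL dF.
have [M AM] := rV_left_inverse inj_i.
have [K K0 MK] := rV_linear_bounded (mulmxr M : {linear 'rV[R]_n -> 'rV[R]_m}).
pose B : {linear T -> 'rV[R]_m} := mulmxr M \o 'd (i \o L) t.
have cB : continuous B.
  move=> x; apply: continuous_comp; first exact: diff_continuous.
  exact: (@rV_linear_continuous _ _ _ (mulmxr M)).
have [b b0 Bb] : exists2 b : R, 0 < b & forall v, `|B v| <= b * `|v|.
  by apply/pinfty_ex_gt0/linear_boundedP/linear_bounded_continuous.
suff : forall e : R, 0 < e ->
    \forall s \near t, `|L s - L t - B (s - t)| <= e * `|s - t|.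
  by move=> /(near_differentiable cB)[].
move=> e e0.
(* The rate [e1] lets half of the norm of [L s - L t] be absorbed, which yields the Lipschitz
   constant [2 * b + e]. The rates [e2] (for [i \o L]) and [e3] (for [i], after the Lipschitz bound)
   each account for [e / 2] in the final estimate. *)
pose e1 : R := (2 * K)^-1.
pose e2 : R := e / (2 * K).
pose e3 : R := e2 / (2 * b + e).
have K20 : 0 < 2 * K by rewrite mulr_gt0.
have be0 : 0 < 2 * b + e by rewrite addr_gt0 ?mulr_gt0.
have e10 : 0 < e1 by rewrite invr_gt0.
have e20 : 0 < e2 by rewrite divr_gt0.
have e30 : 0 < e3 by rewrite divr_gt0.
have n1 := cL _ (differentiable_near di e10).
have n3 := cL _ (differentiable_near di e30).
have n2 := differentiable_near dF e20.
near=> s.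
have H1 : `|i (L s) - i (L t) - 'd i (L t) (L s - L t)| <= e1 * `|L s - L t|.
  by near: s.
have H3 : `|i (L s) - i (L t) - 'd i (L t) (L s - L t)| <= e3 * `|L s - L t|.
  by near: s.
have H2 : `|i (L s) - i (L t) - 'd (i \o L) t (s - t)| <= e2 * `|s - t|.
  by near: s.
set E := i (L s) - i (L t) - _ in H1 H3.
set E' := i (L s) - i (L t) - _ in H2.
have LE : L s - L t - B (s - t) = (E' - E) *m M.
  rewrite -[L s - L t in LHS]AM -[B _]/('d (i \o L) t (s - t) *m M) -mulmxBl.
  by congr (_ *m M); apply/rowP => j; rewrite /E /E' !mxE; ring.
have MLE : `|L s - L t - B (s - t)| <= K * (`|E'| + `|E|).
  rewrite LE; apply: le_trans (MK _) _.
  by rewrite ler_pM2l //; exact: ler_normB.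
have Ke1 : K * e1 = 2^-1 by rewrite /e1 invfM mulrCA divff ?mulr1 // gt_eqF.
have Ke2 : K * e2 = e / 2.
  by rewrite /e2 invfM mulrCA [2^-1 * _]mulrC [K * _]mulrA divff ?mul1r // gt_eqF.
have Ke3 : K * e3 * (2 * b + e) = e / 2 by rewrite mulrA divfK ?gt_eqF.
have KE1 : K * `|E| <= K * e1 * `|L s - L t| by rewrite -mulrA ler_pM2l.
have KE3 : K * `|E| <= K * e3 * `|L s - L t| by rewrite -mulrA ler_pM2l.
have KE' : K * `|E'| <= K * e2 * `|s - t| by rewrite -mulrA ler_pM2l.
have Lst : `|L s - L t| <= (2 * b + e) * `|s - t|.
  have : `|L s - L t| <= `|L s - L t - B (s - t)| + `|B (s - t)|.
    by rewrite -{1}[L s - L t](subrK (B (s - t))) ler_normD.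
  have := Bb (s - t).
  by rewrite Ke1 Ke2 mulrDr in KE1 KE' MLE; lra.
have : K * e3 * `|L s - L t| <= e / 2 * `|s - t|.
  by rewrite -Ke3 -[leRHS]mulrA ler_pM2l // mulr_gt0.
by rewrite Ke2 mulrDr in KE' MLE; lra.
Unshelve. all: by end_near. Qed.

End MetricRegularity.

(** * Tangent maps of manifolds *)

Section TangentMaps.
Context {R : realType}.
Implicit Types M N P : manifold R.

(** Continuity is asked separately: the values of the total map [chart (f p)] off [dom (f p)] carry
    no information on [f], so the chart expression alone does not control it. *)
Definition mdifferentiable M N (f : M -> N) (p : M) : Prop :=
  {for p, continuous f} /\
  differentiable (chart (f p) \o f \o unchart p) (chart p p).

Lemma cod_chart M (p : M) : cod p (chart p p).
Proof. exact: chart_cod (mem_dom p). Qed.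

Lemma unchart_chart M (p : M) : unchart p (chart p p) = p.
Proof. exact: chartK (mem_dom p). Qed.

Lemma smooth_mdifferentiable M N (f : M -> N) p :
  smooth_map f -> mdifferentiable f p.
Proof.
move=> [fc fs]; split; first exact: fc.
apply: (fs p [::]); split; first exact: cod_chart.
by rewrite unchart_chart; exact: mem_dom.
Qed.

Lemma near_unchart M (p : M) (A : set M) :
  nbhs p A -> \forall x \near chart p p, cod p x /\ A (unchart p x).
Proof.
move=> nA; apply: filterI.
  by apply: open_nbhs_nbhs; split; [exact: open_cod | exact: cod_chart].
have := unchart_continuous (cod_chart p).
by apply; rewrite unchart_chart.
Qed.

Lemma near_unchart_dom M N (f : M -> N) p : {for p, continuous f} ->
  \forall x \near chart p p, cod p x /\ dom (f p) (f (unchart p x)).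
Proof.
move=> fc; have nd : nbhs (f p) (dom (f p)).
  by apply: open_nbhs_nbhs; split; [exact: open_dom | exact: mem_dom].
exact: near_unchart (fc _ nd).
Qed.

(** By continuity [f] sends points near [p] into [dom (f p)], where the intermediate chart and its
    inverse cancel. The chart expression of the composite is thus the composite of chart expressions
    near [p], and the chain rule for normed spaces applies. *)
Lemma mdifferentiable_tmap_comp M N P (f : M -> N) (g : N -> P) p :
  mdifferentiable f p -> mdifferentiable g (f p) ->
  mdifferentiable (g \o f) p /\
  tmap (g \o f) p = tmap g (f p) \o tmap f p :> (_ -> _).
Proof.
move=> [fc fd] [gc gd].
have gfc : {for p, continuous (g \o f)} by exact: continuous_comp.
pose lf := chart (f p) \o f \o unchart p.
pose lg := chart (g (f p)) \o g \o unchart (f p).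
have lfp : lf (chart p p) = chart (f p) (f p) by rewrite /lf /= unchart_chart.
have gd' : differentiable lg (lf (chart p p)) by rewrite lfp.
have E : \forall x \near chart p p,
    (lg \o lf) x = (chart (g (f p)) \o (g \o f) \o unchart p) x.
  by have := near_unchart_dom fc; apply: filterS => x [_ dx]; rewrite /lg /lf /= chartK.
have [gfd dE] := near_eq_diff E (differentiable_comp fd gd').
split; first by split.
by rewrite /tmap -lfp dE diff_comp.
Qed.

Lemma mdifferentiable_comp M N P (f : M -> N) (g : N -> P) p :
  mdifferentiable f p -> mdifferentiable g (f p) -> mdifferentiable (g \o f) p.
Proof. by move=> fd gd; have [] := mdifferentiable_tmap_comp fd gd. Qed.

Lemma tmap_comp M N P (f : M -> N) (g : N -> P) p v :
  mdifferentiable f p -> mdifferentiable g (f p) ->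
  tmap (g \o f) p v = tmap g (f p) (tmap f p v).
Proof. by move=> fd gd; have [_ ->] := mdifferentiable_tmap_comp fd gd. Qed.

(** This serves the identity and the two projections, which are linear in the preferred charts
    because the charts of a product are juxtaposed row vectors. *)
Lemma near_linear_mdifferentiable M N (f : M -> N) p
    (A : {linear 'rV[R]_(mdim M) -> 'rV[R]_(mdim N)}) :
  {for p, continuous f} ->
  (\forall x \near chart p p, A x = (chart (f p) \o f \o unchart p) x) ->
  mdifferentiable f p /\ tmap f p = A :> (_ -> _).
Proof.
move=> fc AE.
have cA : continuous A by exact: rV_linear_continuous.
have [fd dE] := near_eq_diff AE (linear_differentiable _ cA).
by split; [split | rewrite /tmap dE diff_lin].
Qed.

Lemma mdifferentiable_tmap_id M (p : M) :
  mdifferentiable id p /\ tmap id p = id :> ('rV[R]_(mdim M) -> _).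
Proof.
apply: (@near_linear_mdifferentiable M M id p idfun) => //.
have := @near_unchart_dom M M id p (fun A nA => nA).
by apply: filterS => x [cx _] /=; rewrite unchartK.
Qed.

Lemma mdifferentiable_id M (p : M) : mdifferentiable id p.
Proof. by have [] := mdifferentiable_tmap_id p. Qed.

Lemma tmap_id M (p : M) v : tmap id p v = v.
Proof. by have [_ ->] := mdifferentiable_tmap_id p. Qed.

Lemma mdifferentiable_tmap_cst M N (q : N) (p : M) :
  mdifferentiable (fun _ : M => q) p /\ forall v, tmap (fun _ : M => q) p v = 0.
Proof.
split; first by split; [exact: cst_continuous | exact: differentiable_cst].
by move=> v; rewrite /tmap diff_cst.
Qed.

Lemma mdifferentiable_cst M N (q : N) (p : M) : mdifferentiable (fun _ : M => q) p.
Proof. by have [] := mdifferentiable_tmap_cst q p. Qed.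

Lemma tmap_cst M N (q : N) (p : M) v : tmap (fun _ : M => q) p v = 0.
Proof. by have [_ ->] := mdifferentiable_tmap_cst q p. Qed.

Lemma mdifferentiable_tmap_fst M N (p : mprod M N) :
  mdifferentiable (fst : mprod M N -> M) p /\
  tmap (fst : mprod M N -> M) p = lsubmx :> (_ -> _).
Proof.
have fc : {for p, continuous (fst : mprod M N -> M)} by exact: cvg_fst.
apply: near_linear_mdifferentiable => //.
have := near_unchart_dom fc; apply: filterS => x [[c1 c2] _] /=.
by rewrite unchartK.
Qed.

Lemma mdifferentiable_tmap_snd M N (p : mprod M N) :
  mdifferentiable (snd : mprod M N -> N) p /\
  tmap (snd : mprod M N -> N) p = rsubmx :> (_ -> _).
Proof.
have fc : {for p, continuous (snd : mprod M N -> N)} by exact: cvg_snd.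
apply: near_linear_mdifferentiable => //.
have := near_unchart_dom fc; apply: filterS => x [[c1 c2] _] /=.
by rewrite unchartK.
Qed.

Lemma mdifferentiable_pair M N P (f : P -> M) (g : P -> N) p :
  mdifferentiable f p -> mdifferentiable g p ->
  mdifferentiable (fun x => (f x, g x) : mprod M N) p.
Proof.
move=> [fc fd] [gc gd]; split; first exact: (cvg_pair fc gc).
apply: (@differentiable_comp _ _ _ _ _ (@row_pair R (mdim M) (mdim N))
  _ (differentiable_pair fd gd)).
by apply: linear_differentiable; exact: row_pair_continuous.
Qed.

Lemma tmap_pair M N P (f : P -> M) (g : P -> N) p v :
  mdifferentiable f p -> mdifferentiable g p ->
  tmap (fun x => (f x, g x) : mprod M N) p v = row_mx (tmap f p v) (tmap g p v).
Proof.
move=> fd gd; have pd := mdifferentiable_pair fd gd.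
have [d1 t1] := mdifferentiable_tmap_fst (f p, g p).
have [d2 t2] := mdifferentiable_tmap_snd (f p, g p).
rewrite -[LHS]hsubmxK -t1 -t2; congr (row_mx _ _).
  by have /= <- := tmap_comp v pd d1.
by have /= <- := tmap_comp v pd d2.
Qed.

Lemma tmap0 M N (f : M -> N) (p : M) : tmap f p 0 = 0.
Proof. exact: linear0. Qed.

Lemma tmapD M N (f : M -> N) (p : M) u v : tmap f p (u + v) = tmap f p u + tmap f p v.
Proof. exact: linearD. Qed.

Lemma tmapN M N (f : M -> N) (p : M) u : tmap f p (- u) = - tmap f p u.
Proof. exact: linearN. Qed.

Lemma tmapP M N (f : M -> N) (p : M) a u v :
  tmap f p (a *: u + v) = a *: tmap f p u + tmap f p v.
Proof. exact: linearP. Qed.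

End TangentMaps.

(** * Lifts through embeddings and curves over submersions *)

Section EmbeddingLift.
Context {R : realType}.
Implicit Types M Q P : manifold R.

(** Continuity of [L] comes from the topology of the source being induced by [i]; differentiability
    then follows in charts from [differentiable_lift], since [tmap i] is injective. *)
Lemma embedding_lift (T : normedModType R) M Q (i : M -> Q) (L : T -> M) (t : T) :
  embedding i -> {for t, continuous (i \o L)} ->
  differentiable (chart (i (L t)) \o (i \o L)) t ->
  [/\ {for t, continuous L}, differentiable (chart (L t) \o L) t &
      forall v, tmap i (L t) ('d (chart (L t) \o L) t v) =
                'd (chart (i (L t)) \o (i \o L)) t v].
Proof.
move=> [si _ ti ei] ciL diL.
have cL : {for t, continuous L}.
  move=> A; rewrite nbhsE => -[U [oU UL] UA].
  have [V oV UV] := ei U oU.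
  have : nbhs t ((i \o L) @^-1` V).
    by apply: ciL; apply: open_nbhs_nbhs; split => //; move: UL; rewrite UV.
  by apply: filterS => s Vs; apply: UA; rewrite UV.
have [_ di] := smooth_mdifferentiable (L t) si.
pose l := chart (L t) \o L.
have cl : {for t, continuous l}.
  exact: (continuous_comp cL (chart_continuous (mem_dom (L t)))).
have E : \forall s \near t, (chart (i (L t)) \o (i \o L)) s =
    ((chart (i (L t)) \o i \o unchart (L t)) \o l) s.
  have : nbhs t (L @^-1` dom (L t)).
    by apply: cL; apply: open_nbhs_nbhs; split; [exact: open_dom | exact: mem_dom].
  by apply: filterS => s ds; rewrite /l /= chartK.
have [dl dlE] := near_eq_diff E diL.
pose li := chart (i (L t)) \o i \o unchart (L t).
have dL : differentiable l t :=
  @differentiable_lift R T _ _ li l t di (ti (L t)) cl dl.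
split; [exact: cL | exact: dL | move=> v].
have dc := @diff_comp _ _ _ _ l li t dL di.
rewrite -dlE; exact: (esym (congr1 (fun F : T -> _ => F v) dc)).
Qed.

(** The previous lemma is applied to [L] read in the chart of the source; composing with [chart p]
    brings continuity back to the manifold. *)
Lemma mdifferentiable_lift M Q P (i : M -> Q) (L : P -> M) (p : P) :
  embedding i -> mdifferentiable (i \o L) p -> mdifferentiable L p.
Proof.
move=> ei [ciL diL].
have cu := unchart_continuous (cod_chart p).
pose Lu := L \o unchart p.
have Lup : Lu (chart p p) = L p by rewrite /Lu /= unchart_chart.
have ciLu : {for chart p p, continuous (i \o Lu)}.
  by apply: (@continuous_comp _ _ _ (unchart p) (i \o L)) => //; rewrite unchart_chart.
have [| cLu dLu _] := embedding_lift ei ciLu.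
  by rewrite Lup.
split; last by rewrite Lup in dLu.
have E : \forall q \near p, Lu (chart p q) = L q.
  have : nbhs p (dom p).
    by apply: open_nbhs_nbhs; split; [exact: open_dom | exact: mem_dom].
  by apply: filterS => q dq; rewrite /Lu /= chartK.
move=> A; rewrite -Lup => nA.
have : nbhs p ((Lu \o chart p) @^-1` A).
  have := continuous_comp (chart_continuous (mem_dom p)) cLu.
  by apply.
by apply: filterS2 E => q Eq; rewrite /preimage /= Eq.
Qed.

Lemma rV_line_differentiable m n (a : 'rV[R]_n) (v : 'M[R]_(m, n)) (t : 'rV[R]_m) :
  differentiable (fun s => a + s *m v) t /\
  'd (fun s => a + s *m v) t = mulmxr v :> ('rV[R]_m -> 'rV[R]_n).
Proof.
apply: near_differentiable; first exact: rV_linear_continuous.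
move=> e e0; near=> s.
by rewrite /= opprD addrACA subrr add0r -mulmxBl subrr normr0 mulr_ge0 // ltW.
Unshelve. all: by end_near. Qed.

Lemma chart_line M (p : M) (v : 'rV[R]_(mdim M)) (A : set M) : nbhs p A ->
  \forall s \near (0 : 'rV[R]_1),
    cod p (chart p p + s *m v) /\ A (unchart p (chart p p + s *m v)).
Proof.
move=> nA.
have lc := differentiable_continuous (rV_line_differentiable (chart p p) v (0 : 'rV[R]_1)).1.
have nc : nbhs (chart p p + (0 : 'rV[R]_1) *m v)
    [set x | cod p x /\ A (unchart p x)].
  by rewrite mul0mx addr0; exact: near_unchart nA.
exact: lc _ nc.
Qed.

Lemma open_local_domain M Q (f : M -> Q) p : continuous f ->
  open [set x | cod p x /\ dom (f p) (f (unchart p x))].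
Proof.
move=> fc; rewrite openE => x [cx dx].
have n1 : nbhs x (cod p) by apply: open_nbhs_nbhs; split => //; exact: open_cod.
have n2 : nbhs x ((f \o unchart p) @^-1` dom (f p)).
  apply: (continuous_comp (unchart_continuous cx) (fc _)).
  by apply: open_nbhs_nbhs; split => //; exact: open_dom.
exact: filterI.
Qed.

(* Metric regularity corrects the straight line of direction [W] by [o(s)] into a
   curve [c] that [f] maps to the [k]-image of the straight line of direction [Z]. *)
Lemma submersion_curve M P Q (f : M -> Q) (k : P -> Q) (x : M) (y : P)
    (W : 'rV[R]_(mdim M)) (Z : 'rV[R]_(mdim P)) :
  submersion f -> smooth_map k -> f x = k y -> tmap f x W = tmap k y Z ->
  exists c : 'rV[R]_1 -> 'rV[R]_(mdim M),
    [/\ c 0 = chart x x, differentiable c 0,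
        'd c 0 = mulmxr W :> ('rV[R]_1 -> _) &
        \forall s \near (0 : 'rV[R]_1), cod x (c s) /\
          f (unchart x (c s)) = k (unchart y (chart y y + s *m Z))].
Proof.
move=> [[fc fs] fsub] sk fxy TWZ.
pose F := chart (f x) \o f \o unchart x.
pose K := chart (f x) \o k \o unchart y.
have [kc kd] := smooth_mdifferentiable y sk.
have dK : differentiable K (chart y y) by rewrite /K fxy.
have Fx : F (chart x x) = chart (f x) (f x) by rewrite /F /= unchart_chart.
have Ky : K (chart y y) = chart (f x) (f x) by rewrite /K /= unchart_chart fxy.
pose U := [set z | cod x z /\ dom (f x) (f (unchart x z))].
have oU : open U by exact: open_local_domain.
have Ux : U (chart x x).
  by split; [exact: cod_chart | rewrite unchart_chart; exact: mem_dom].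
have dF : differentiable F (chart x x) by exact: (fs x [::]).
have [C [d [C0 d0 Fd]]] := smooth_metric_regularity oU Ux (fs x) (fsub x).
pose lx (s : 'rV[R]_1) := chart x x + s *m W.
pose ly (s : 'rV[R]_1) := chart y y + s *m Z.
have [dlx dlxE] : differentiable lx (0 : 'rV[R]_1) /\
    'd lx (0 : 'rV[R]_1) = mulmxr W :> (_ -> _).
  exact: rV_line_differentiable.
have [dly dlyE] : differentiable ly (0 : 'rV[R]_1) /\
    'd ly (0 : 'rV[R]_1) = mulmxr Z :> (_ -> _).
  exact: rV_line_differentiable.
have lx0 : lx 0 = chart x x by rewrite /lx mul0mx addr0.
have ly0 : ly 0 = chart y y by rewrite /ly mul0mx addr0.
have dF' : differentiable F (lx 0) by rewrite lx0.
have dK' : differentiable K (ly 0) by rewrite ly0.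
have dFl : differentiable (F \o lx) (0 : 'rV[R]_1) by exact: differentiable_comp.
have dKl : differentiable (K \o ly) (0 : 'rV[R]_1) by exact: differentiable_comp.
(* [E] measures how far the straight line is from solving the equation. It vanishes at 0, and so
   does its differential because [W] and [Z] have the same image; a correction bounded by [C] times
   [E] therefore does not change the velocity. *)
pose E := (K \o ly) - (F \o lx).
have dE : differentiable E (0 : 'rV[R]_1) by exact: differentiableB.
have E0 : E 0 = 0 by rewrite /E !fctE /= lx0 ly0 Fx Ky subrr.
have dE0 s : 'd E (0 : 'rV[R]_1) s = 0.
  have EB : 'd E (0 : 'rV[R]_1) =
      'd (K \o ly) (0 : 'rV[R]_1) \- 'd (F \o lx) (0 : 'rV[R]_1) :> (_ -> _).
    exact: diffB.
  have KE : 'd (K \o ly) (0 : 'rV[R]_1) s = 'd K (ly 0) (s *m Z).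
    have := congr1 (fun G : 'rV[R]_1 -> _ => 'd K (ly 0) (G s)) dlyE.
    by apply: etrans; exact: (congr1 (fun G : 'rV[R]_1 -> _ => G s) (diff_comp dly dK')).
  have FE : 'd (F \o lx) (0 : 'rV[R]_1) s = 'd F (lx 0) (s *m W).
    have := congr1 (fun G : 'rV[R]_1 -> _ => 'd F (lx 0) (G s)) dlxE.
    by apply: etrans; exact: (congr1 (fun G : 'rV[R]_1 -> _ => G s) (diff_comp dlx dF')).
  have sv n (v : 'rV[R]_n) : s *m v = s 0 0 *: v.
    by apply/rowP => j; rewrite !mxE big_ord1.
  have EBs := congr1 (fun G : 'rV[R]_1 -> _ => G s) EB.
  apply: etrans EBs _; rewrite -[LHS]/('d (K \o ly) (0 : 'rV[R]_1) s - 'd (F \o lx) (0 : 'rV[R]_1) s).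
  have KZ : 'd K (ly 0) (s *m Z) = s 0 0 *: 'd K (ly 0) Z.
    by rewrite sv; exact: linearZ.
  have FW : 'd F (lx 0) (s *m W) = s 0 0 *: 'd F (lx 0) W.
    by rewrite sv; exact: linearZ.
  have FWKZ : 'd F (lx 0) W = 'd K (ly 0) Z.
    by rewrite lx0 ly0; move: TWZ; rewrite /tmap -fxy.
  have KFE := etrans KE (etrans KZ (congr1 ( *:%R (s 0 0)) (esym FWKZ))).
  exact: (etrans (congr2 (fun a b => a - b) KFE (etrans FE FW)) (subrr _)).
have n1 : \forall s \near (0 : 'rV[R]_1), `|lx s - chart x x| < d.
  have := differentiable_continuous dlx.
  move=> /cvgrPdist_lt /(_ d d0); apply: filterS => s.
  by rewrite lx0 distrC.
have n2 : \forall s \near (0 : 'rV[R]_1), `|K (ly s) - F (chart x x)| < d.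
  have := differentiable_continuous dKl.
  move=> /cvgrPdist_lt /(_ d d0); apply: filterS => s.
  by rewrite /= ly0 Ky Fx distrC.
(* Metric regularity is local, so [c] takes the junk value 0 at parameters where the lines leave the
   ball; only [s] near 0 matters. *)
have /choice[c cP] : forall s, exists z,
    `|lx s - chart x x| < d -> `|K (ly s) - F (chart x x)| < d ->
    F z = K (ly s) /\ `|z - lx s| <= C * `|E s|.
  move=> s.
  have [[h1 h2]|h] := pselect (`|lx s - chart x x| < d /\ `|K (ly s) - F (chart x x)| < d).
    by have [z Fz zE] := Fd _ _ h1 h2; exists z.
  by exists 0 => h1 h2; case: h.
have c0 : c 0 = chart x x.
  have [||_] := cP 0; rewrite ?lx0 ?ly0 ?Ky ?Fx ?subrr ?normr0 //.
  by rewrite E0 normr0 mulr0 normr_le0 subr_eq0 => /eqP.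
have [dc dcE] : differentiable c (0 : 'rV[R]_1) /\
    'd c (0 : 'rV[R]_1) = mulmxr W :> ('rV[R]_1 -> _).
  apply: near_differentiable; first exact: rV_linear_continuous.
  move=> e e0; have eC0 : 0 < e / C by rewrite divr_gt0.
  have nE := differentiable_near dE eC0.
  near=> s.
  have s1 : `|lx s - chart x x| < d by near: s.
  have s2 : `|K (ly s) - F (chart x x)| < d by near: s.
  have sE : `|E s - E 0 - 'd E (0 : 'rV[R]_1) (s - 0)| <= e / C * `|s - 0|.
    by near: s.
  have [_ cs] := cP s s1 s2.
  have -> : c s - c 0 - mulmxr W (s - 0) = c s - lx s.
    by rewrite c0 /lx /= subr0 opprD addrA.
  apply: le_trans cs _; rewrite -ler_pdivlMl // mulrA [C^-1 * e]mulrC.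
  by apply: le_trans sE; rewrite E0 dE0 !subr0.
exists c; split => //.
(* So far the two images agree in the chart at [f x] only. Equality of points follows once both are
   known to lie in the domain of that chart. *)
have n3 : \forall z \near c 0, cod x z /\ dom (f x) (f (unchart x z)).
  by rewrite c0; exact: (near_unchart_dom (fc x)).
have n4 : \forall s \near (0 : 'rV[R]_1), cod x (c s) /\ dom (f x) (f (unchart x (c s))).
  have cc := differentiable_continuous dc.
  exact: (cc _ n3).
have n5 : \forall s \near (0 : 'rV[R]_1), cod y (ly s) /\ dom (f x) (k (unchart y (ly s))).
  have nd : nbhs (k y) (dom (f x)).
    by rewrite fxy; apply: open_nbhs_nbhs; split; [exact: open_dom | exact: mem_dom].
  exact: (chart_line Z (kc _ nd)).
near=> s.
have [cs dcs] : cod x (c s) /\ dom (f x) (f (unchart x (c s))) by near: s.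
have [_ dls] : cod y (ly s) /\ dom (f x) (k (unchart y (ly s))) by near: s.
split=> //.
have s1 : `|lx s - chart x x| < d by near: s.
have s2 : `|K (ly s) - F (chart x x)| < d by near: s.
have [FK _] := cP s s1 s2.
by rewrite -[LHS](chartK dcs) -[RHS](chartK dls); congr unchart; exact: FK.
Unshelve. all: by end_near. Qed.

End EmbeddingLift.

(** * Tangent vectors to composable pairs *)

Section Groupoid.
Context {R : realType} (H : lie_groupoid R).

(** The tangent space of the composable pairs is the fibre product of tangent spaces. A pair
    [(Z, W)] is realised as the velocity of a curve of composable pairs, lifted to [gcomp] through
    the embedding. *)
Lemma composable_tangent (g h : garr H) (Z W : 'rV[R]_(mdim (garr H))) :
  gsrc H g = gtgt H h -> tmap (gsrc H) g Z = tmap (gtgt H) h W ->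
  exists (c : gcomp H) (v : 'rV[R]_(mdim (gcomp H))),
    gincl c = (g, h) /\ tmap (@gincl _ H) c v = row_mx Z W.
Proof.
move=> gh ZW.
(* The arrow [g] moves along a straight line, and the line through [h] is corrected so that its
   target follows the source of the first arrow. *)
have [c [c0 dc dcE nc]] :=
  submersion_curve (gtgt_submersion H) (gsrc_submersion H).1 (esym gh) (esym ZW).
pose l (s : 'rV[R]_1) := chart g g + s *m Z.
have [dl dlE] : differentiable l (0 : 'rV[R]_1) /\
    'd l (0 : 'rV[R]_1) = mulmxr Z :> (_ -> _).
  exact: rV_line_differentiable.
have l0 : l 0 = chart g g by rewrite /l mul0mx addr0.
pose gam (s : 'rV[R]_1) : mprod (garr H) (garr H) := (unchart g (l s), unchart h (c s)).
have gam0 : gam 0 = (g, h) by rewrite /gam l0 c0 !unchart_chart.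
have inrange p : gsrc H p.1 = gtgt H p.2 -> exists e : gcomp H, gincl e = p.
  move=> sp; have : [set c | gsrc H c.1 = gtgt H c.2] p by [].
  by rewrite -gincl_range => -[e _ ep]; exists e.
have [e0 e0E] : exists e : gcomp H, gincl e = (g, h) by exact: inrange.
(* For large [s] the pair need not be composable; there [L] takes the default value [e0]. *)
have /choice[L LE] : forall s, exists e : gcomp H,
    gsrc H (gam s).1 = gtgt H (gam s).2 -> gincl e = gam s.
  move=> s; have [gs|ns] := pselect (gsrc H (gam s).1 = gtgt H (gam s).2).
    by have [e ee] := inrange _ gs; exists e.
  by exists e0.
have L0 : gincl (L 0) = (g, h) by rewrite LE gam0.
have nL : \forall s \near (0 : 'rV[R]_1), gam s = (@gincl _ H \o L) s.
  by apply: filterS nc => s [_ fs]; rewrite /= LE // /gam /= fs.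
have cl : {for (0 : 'rV[R]_1), continuous (unchart g \o l)}.
  apply: (continuous_comp (differentiable_continuous dl)).
  by rewrite l0; exact: unchart_continuous (cod_chart g).
have cc : {for (0 : 'rV[R]_1), continuous (unchart h \o c)}.
  apply: (continuous_comp (differentiable_continuous dc)).
  by rewrite c0; exact: unchart_continuous (cod_chart h).
have cgam : {for (0 : 'rV[R]_1), continuous gam} := cvg_pair cl cc.
have ciL : {for (0 : 'rV[R]_1), continuous (@gincl _ H \o L)}.
  move=> A; rewrite /= L0 -gam0 => /cgam nA.
  by apply: filterS2 nL nA => s /= <-.
pose F s := row_mx (l s) (c s).
have dF := @differentiable_pair _ _ _ _ l c _ dl dc.
have drow : differentiable (@row_pair R (mdim (garr H)) (mdim (garr H))) (l 0, c 0).
  by apply: linear_differentiable; exact: row_pair_continuous.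
have nF : \forall s \near (0 : 'rV[R]_1),
  row_pair (l s, c s) = (chart (gincl (L 0)) \o (@gincl _ H \o L)) s.
  have ng : nbhs g [set: garr H] by exact: filterT.
  have nl := chart_line Z ng.
  near=> s.
  have gs : gam s = gincl (L s) by near: s.
  have [ls _] : cod g (l s) /\ [set: garr H] (unchart g (l s)) by near: s.
  have [cs _] : cod h (c s) /\
    gtgt H (unchart h (c s)) = gsrc H (unchart g (l s)) by near: s.
  by rewrite /= L0 -[gincl (L s)]gs /= /mprod_chart /gam /= !unchartK.
have [diL diLE] := near_eq_diff nF (differentiable_comp dF drow).
have [_ _ tL] := embedding_lift (gincl_embedding H) ciL diL.
exists (L 0), ('d (chart (L 0) \o L) (0 : 'rV[R]_1) 1%:M).
split; [exact: L0 | apply: etrans (tL _) _].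
apply: etrans (congr1 (fun G : 'rV[R]_1 -> _ => G 1%:M) diLE) _.
apply: etrans (congr1 (fun G : 'rV[R]_1 -> _ => G 1%:M) (diff_comp dF drow)) _.
have rpE : 'd (@row_pair R (mdim (garr H)) (mdim (garr H))) (l 0, c 0) =
    @row_pair R (mdim (garr H)) (mdim (garr H)) :> (_ -> _).
  by apply: diff_lin; exact: row_pair_continuous.
have FE := congr1 (fun G : 'rV[R]_1 -> _ => G 1%:M) (diff_pair dl dc).
have lE : 'd l (0 : 'rV[R]_1) 1%:M = Z by rewrite dlE /= mul1mx.
have cE : 'd c (0 : 'rV[R]_1) 1%:M = W by rewrite dcE /= mul1mx.
apply: etrans (congr1 (fun G : _ * _ -> _ => G _) rpE) _.
apply: etrans (congr1 (@row_pair R (mdim (garr H)) (mdim (garr H))) FE) _.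
exact: congr2 lE cE.
Unshelve. all: by end_near. Qed.

End Groupoid.

(** * Bilinear calculus of 2-forms *)

Section TwoForms.
Context {R : realType}.
Implicit Types M N : manifold R.

(** This puts a pair of vectors in the shape used by [form_linear]; the overwritten entry [z] is
    arbitrary, so one choice serves all three terms of the linearity identity. *)
Lemma tnth2_dfwith0 (T : Type) (x y z : T) :
  tnth [tuple x; y] = dfwith (T := fun _ : 'I_2 => T) (tnth [tuple z; y]) ord0 x.
Proof.
apply/funext => i; case: (eqVneq ord0 i) => [<-|ni].
  by rewrite dfwithin.
rewrite dfwithout //.
by case: i ni => -[|[|//]] //= ?; rewrite !(tnth_nth x).
Qed.

Lemma tnth2_dfwith1 (T : Type) (x y z : T) :
  tnth [tuple x; y] = dfwith (T := fun _ : 'I_2 => T) (tnth [tuple x; z]) ord_max y.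
Proof.
apply/funext => i; case: (eqVneq ord_max i) => [<-|ni].
  by rewrite dfwithin.
rewrite dfwithout //.
by case: i ni => -[|[|//]] //= ?; rewrite !(tnth_nth x).
Qed.

Variables (M : manifold R) (omega : kform M 2).
Hypothesis omegaF : is_form omega.
Variable p : M.
Implicit Types u v w : 'rV[R]_(mdim M).

Lemma ev2_linearl a u v w :
  ev2 omega p (a *: u + v) w = a * ev2 omega p u w + ev2 omega p v w.
Proof.
rewrite /ev2 (tnth2_dfwith0 (a *: u + v) w 0) (form_linear omegaF).
by rewrite -!tnth2_dfwith0.
Qed.

Lemma ev2_linearr a u v w :
  ev2 omega p w (a *: u + v) = a * ev2 omega p w u + ev2 omega p w v.
Proof.
rewrite /ev2 (tnth2_dfwith1 w (a *: u + v) 0) (form_linear omegaF).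
by rewrite -!tnth2_dfwith1.
Qed.

Lemma ev2_0l w : ev2 omega p 0 w = 0.
Proof.
by have := ev2_linearl (-1) 0 0 w; rewrite scaler0 addr0 mulN1r addNr.
Qed.

Lemma ev2_0r w : ev2 omega p w 0 = 0.
Proof.
by have := ev2_linearr (-1) 0 0 w; rewrite scaler0 addr0 mulN1r addNr.
Qed.

Lemma ev2Dl u v w : ev2 omega p (u + v) w = ev2 omega p u w + ev2 omega p v w.
Proof. by rewrite -[u in LHS]scale1r ev2_linearl mul1r. Qed.

Lemma ev2Dr u v w : ev2 omega p w (u + v) = ev2 omega p w u + ev2 omega p w v.
Proof. by rewrite -[u in LHS]scale1r ev2_linearr mul1r. Qed.

Lemma ev2Zl a u w : ev2 omega p (a *: u) w = a * ev2 omega p u w.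
Proof. by rewrite -[a *: u]addr0 ev2_linearl ev2_0l addr0. Qed.

Lemma ev2Nl u w : ev2 omega p (- u) w = - ev2 omega p u w.
Proof. by rewrite -scaleN1r ev2Zl mulN1r. Qed.

Lemma ev2_alt u : ev2 omega p u u = 0.
Proof. exact: (@form_alternating _ _ _ _ omegaF p _ ord0 ord_max). Qed.

Lemma ev2C u v : ev2 omega p u v = - ev2 omega p v u.
Proof.
have := ev2_alt (u + v); rewrite !ev2Dl !ev2Dr !ev2_alt add0r addr0.
by move=> /eqP; rewrite addr_eq0 => /eqP.
Qed.

End TwoForms.

Lemma ev2_pullback (R : realType) (M N : manifold R) (f : M -> N)
    (omega : kform N 2) p u v :
  ev2 (pullback f omega) p u v = ev2 omega (f p) (tmap f p u) (tmap f p v).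
Proof.
rewrite /ev2 /pullback; congr (omega _ _); apply/funext => i.
by case: i => -[|[|//]] //= ?; rewrite !(tnth_nth 0).
Qed.

(** * Tangent maps of the groupoid structure *)

Section GroupoidTangent.
Context {R : realType} (H : lie_groupoid R).
Local Notation tH := 'rV[R]_(mdim (garr H)).

Definition gcompm (c : gcomp H) : garr H := gmul (gincl c).1 (gincl c).2.

Lemma gincl_mdifferentiable c : mdifferentiable (@gincl _ H) c.
Proof. by apply: smooth_mdifferentiable; have [] := gincl_embedding H. Qed.

Lemma gcompm_mdifferentiable c : mdifferentiable gcompm c.
Proof. exact: (smooth_mdifferentiable c (gmul_smooth H)). Qed.

Lemma gsrc_mdifferentiable h : mdifferentiable (gsrc H) h.
Proof. exact: smooth_mdifferentiable (gsrc_submersion H).1. Qed.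

Lemma gtgt_mdifferentiable h : mdifferentiable (gtgt H) h.
Proof. exact: smooth_mdifferentiable (gtgt_submersion H).1. Qed.

Lemma gunit_mdifferentiable x : mdifferentiable (gunit H) x.
Proof. exact: smooth_mdifferentiable (gunit_smooth H). Qed.

Lemma tmap_gsrc_gunit x w : tmap (gsrc H) (gunit H x) (tmap (gunit H) x w) = w.
Proof.
rewrite -tmap_comp; [|exact: gunit_mdifferentiable|exact: gsrc_mdifferentiable].
have -> : gsrc H \o gunit H = id by apply/funext => y; exact: gsrc_unit.
exact: tmap_id.
Qed.

Lemma tmap_gtgt_gunit x w : tmap (gtgt H) (gunit H x) (tmap (gunit H) x w) = w.
Proof.
rewrite -tmap_comp; [|exact: gunit_mdifferentiable|exact: gtgt_mdifferentiable].
have -> : gtgt H \o gunit H = id by apply/funext => y; exact: gtgt_unit.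
exact: tmap_id.
Qed.

Lemma tmap_comp1 c v :
  tmap (fun c : gcomp H => (gincl c).1) c v = lsubmx (tmap (@gincl _ H) c v).
Proof.
have [d t] := @mdifferentiable_tmap_fst _ (garr H) (garr H) (gincl c).
by have := tmap_comp v (gincl_mdifferentiable c) d; rewrite t.
Qed.

Lemma tmap_comp2 c v :
  tmap (fun c : gcomp H => (gincl c).2) c v = rsubmx (tmap (@gincl _ H) c v).
Proof.
have [d t] := @mdifferentiable_tmap_snd _ (garr H) (garr H) (gincl c).
by have := tmap_comp v (gincl_mdifferentiable c) d; rewrite t.
Qed.

Lemma comp1_mdifferentiable c : mdifferentiable (fun c : gcomp H => (gincl c).1) c.
Proof.
have [d t] := @mdifferentiable_tmap_fst _ (garr H) (garr H) (gincl c).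
exact: (mdifferentiable_comp (gincl_mdifferentiable c) d).
Qed.

Lemma comp2_mdifferentiable c : mdifferentiable (fun c : gcomp H => (gincl c).2) c.
Proof.
have [d t] := @mdifferentiable_tmap_snd _ (garr H) (garr H) (gincl c).
exact: (mdifferentiable_comp (gincl_mdifferentiable c) d).
Qed.

(** A section [F] of the multiplication lifts to a differentiable map into [gcomp], whose composite
    with [gcompm] is the identity. Its tangent map therefore produces vectors tangent to composable
    pairs with a prescribed product, without any formula for the differential of the
    multiplication. *)
Lemma composable_section (F : garr H -> mprod (garr H) (garr H)) c h (W : tH) :
  (forall h', mdifferentiable F h') ->
  (forall h', gsrc H (F h').1 = gtgt H (F h').2) ->
  (forall h', gmul (F h').1 (F h').2 = h') ->
  gincl c = F h ->
  exists w, tmap (@gincl _ H) c w = tmap F h W /\ tmap gcompm c w = W.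
Proof.
move=> Fd Fc Fm cF.
have /choice[L LF] : forall h', exists e : gcomp H, gincl e = F h'.
  move=> h'; have : [set c | gsrc H c.1 = gtgt H c.2] (F h') by exact: Fc.
  by rewrite -gincl_range => -[e _ ep]; exists e.
have iL : @gincl _ H \o L = F by apply/funext => h' /=.
have [_ inj_i _ _] := gincl_embedding H.
have Lh : L h = c by apply: inj_i; rewrite LF.
have Ld : mdifferentiable L h.
  by apply: (mdifferentiable_lift (gincl_embedding H)); rewrite iL.
exists (tmap L h W); rewrite -Lh; split.
  by rewrite -tmap_comp ?iL //; exact: gincl_mdifferentiable.
rewrite -tmap_comp //; last exact: gcompm_mdifferentiable.
have -> : gcompm \o L = id by apply/funext => h'; rewrite /gcompm /= LF Fm.
exact: tmap_id.
Qed.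

Lemma left_unit_tangent c h (W : tH) : gincl c = (gunit H (gtgt H h), h) ->
  exists w, tmap (@gincl _ H) c w =
      row_mx (tmap (gunit H) (gtgt H h) (tmap (gtgt H) h W)) W /\
    tmap gcompm c w = W.
Proof.
have dt h' : mdifferentiable (gunit H \o gtgt H) h'.
  exact: mdifferentiable_comp (gtgt_mdifferentiable h') (gunit_mdifferentiable _).
move=> /(@composable_section (fun h' => (gunit H (gtgt H h'), h')) c h W)[].
- by move=> h'; exact: mdifferentiable_pair (dt h') (mdifferentiable_id h').
- by move=> h' /=; exact: gsrc_unit.
- by move=> h' /=; exact: gmul_unitl.
move=> w [wE wm]; exists w; split=> //; rewrite wE.
apply: etrans (tmap_pair W (dt h) (mdifferentiable_id h)) _.
apply: congr2 (tmap_id h W).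
exact: (tmap_comp W (gtgt_mdifferentiable h) (gunit_mdifferentiable _)).
Qed.

Lemma right_unit_tangent c h (W : tH) : gincl c = (h, gunit H (gsrc H h)) ->
  exists w, tmap (@gincl _ H) c w =
      row_mx W (tmap (gunit H) (gsrc H h) (tmap (gsrc H) h W)) /\
    tmap gcompm c w = W.
Proof.
have ds h' : mdifferentiable (gunit H \o gsrc H) h'.
  exact: mdifferentiable_comp (gsrc_mdifferentiable h') (gunit_mdifferentiable _).
move=> /(@composable_section (fun h' => (h', gunit H (gsrc H h'))) c h W)[].
- by move=> h'; exact: mdifferentiable_pair (mdifferentiable_id h') (ds h').
- by move=> h' /=; rewrite gtgt_unit.
- by move=> h' /=; exact: gmul_unitr.
move=> w [wE wm]; exists w; split=> //; rewrite wE.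
apply: etrans (tmap_pair W (mdifferentiable_id h) (ds h)) _.
apply: congr2 (tmap_id h W) _.
exact: (tmap_comp W (gsrc_mdifferentiable h) (gunit_mdifferentiable _)).
Qed.

End GroupoidTangent.

(** * Translates in a lagrangian morphism *)

Section LieGroupTangent.
Context {R : realType} (D : lie_group R).
Local Notation dd := 'rV[R]_(mdim D).

(** The group axioms are one-sided: the right inverse law is derived first, then the right unit
    law. *)
Lemma lmul1r (k : D) : lmul k (lone D) = k.
Proof.
have VK : forall x : D, lmul x (linv x) = lone D.
  move=> x; rewrite -[LHS]lmul1l -{1}(lmulVl (linv x)) -lmulA.
  by rewrite [lmul (linv x) _]lmulA lmulVl lmul1l lmulVl.
by rewrite -(lmulVl k) lmulA VK lmul1l.
Qed.

Lemma lmul_mdifferentiable (p : mprod D D) :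
  mdifferentiable (fun k : mprod D D => lmul k.1 k.2) p.
Proof. exact: smooth_mdifferentiable (@lmul_smooth _ D). Qed.

Lemma tmap_lmul_comp (M : manifold R) (f g : M -> D) (p : M) v :
  mdifferentiable f p -> mdifferentiable g p ->
  tmap (fun x => lmul (f x) (g x)) p v =
  tmap (fun k : mprod D D => lmul k.1 k.2) (f p, g p)
    (row_mx (tmap f p v) (tmap g p v)).
Proof.
move=> df dg.
have := tmap_comp v (mdifferentiable_pair df dg) (lmul_mdifferentiable _).
by rewrite (tmap_pair v df dg).
Qed.

Lemma tmap_lmul_l (a b : D) (u : dd) :
  tmap (fun k : mprod D D => lmul k.1 k.2) (a, b) (row_mx u 0) =
  tmap (rtrans b) a u.
Proof.
apply: esym; apply: etrans (tmap_lmul_comp u (mdifferentiable_id a) (mdifferentiable_cst b a)) _.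
exact: (congr1 (tmap (fun k : mprod D D => lmul k.1 k.2) (a, b))
  (congr2 row_mx (tmap_id a u) (tmap_cst b a u))).
Qed.

Lemma tmap_lmul_r (a b : D) (u : dd) :
  tmap (fun k : mprod D D => lmul k.1 k.2) (a, b) (row_mx 0 u) =
  tmap (ltrans a) b u.
Proof.
apply: esym; apply: etrans (tmap_lmul_comp u (mdifferentiable_cst a b) (mdifferentiable_id b)) _.
exact: (congr1 (tmap (fun k : mprod D D => lmul k.1 k.2) (a, b))
  (congr2 row_mx (tmap_cst a b u) (tmap_id b u))).
Qed.

Lemma rinv_field1 u : rinv_field u (lone D) = u.
Proof.
rewrite /rinv_field (_ : rtrans (lone D) = id) ?tmap_id //.
by apply/funext => x; exact: lmul1r.
Qed.

Lemma linv_field1 u : linv_field u (lone D) = u.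
Proof.
rewrite /linv_field (_ : ltrans (lone D) = id) ?tmap_id //.
by apply/funext => x; exact: lmul1l.
Qed.

Lemma tmap_rtrans1 (a : D) u : tmap (rtrans (lone D)) a u = u.
Proof.
rewrite (_ : rtrans (lone D) = id) ?tmap_id //.
by apply/funext => x; exact: lmul1r.
Qed.

Lemma tmap_ltrans1 (a : D) u : tmap (ltrans (lone D)) a u = u.
Proof.
rewrite (_ : ltrans (lone D) = id) ?tmap_id //.
by apply/funext => x; exact: lmul1l.
Qed.

End LieGroupTangent.

(** * Multiplicativity of sigma and translates of algebroid vectors *)

Section Lagrangian.
Context {R : realType} (D : lie_group R).
Local Notation DD := (mprod D D).
Variables (Omega : kform DD 2) (Theta : kform D 3).
Variables (H : lie_groupoid R) (Phi : garr H -> D) (sigma : kform (garr H) 2).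
Hypothesis OmegaF : is_form Omega.
Hypothesis lagr : lagrangian_morphism Omega Theta Phi sigma.
Local Notation tH := 'rV[R]_(mdim (garr H)).

Let Phi_morph := lag_morphism lagr.
Let sigmaF := lag_form lagr.

Lemma Phi_mdifferentiable h : mdifferentiable Phi h.
Proof. exact: smooth_mdifferentiable (gmor_smooth Phi_morph). Qed.

Lemma tmap_Phi_gunit x w : tmap Phi (gunit H x) (tmap (gunit H) x w) = 0.
Proof.
rewrite -tmap_comp; [|exact: gunit_mdifferentiable|exact: Phi_mdifferentiable].
have -> : Phi \o gunit H = fun=> lone D.
  by apply/funext => y; exact: gmor_unit Phi_morph y.
exact: tmap_cst.
Qed.

Lemma sigma_unit x u v :
  ev2 sigma (gunit H x) (tmap (gunit H) x u) (tmap (gunit H) x v) = 0.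
Proof. by rewrite -ev2_pullback (lag_unit lagr). Qed.

(** Multiplicativity of [sigma] evaluated on two tangent vectors of [gcomp]. Points and vectors
    enter through equations, so that products with units can be replaced by their simplified values
    inside the forms. *)
Lemma sigma_gcompm (c : gcomp H) g h k a b v w Z Z' W W' V V' A A' B B' :
  gincl c = (g, h) -> gmul g h = k -> Phi g = a -> Phi h = b ->
  tmap (@gincl _ H) c v = row_mx Z W -> tmap (@gincl _ H) c w = row_mx Z' W' ->
  tmap (@gcompm _ H) c v = V -> tmap (@gcompm _ H) c w = V' ->
  tmap Phi g Z = A -> tmap Phi g Z' = A' ->
  tmap Phi h W = B -> tmap Phi h W' = B' ->
  ev2 sigma k V V' = ev2 sigma g Z Z' + ev2 sigma h W W'
    - ev2 Omega (a, b) (row_mx A B) (row_mx A' B').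
Proof.
move=> cE <- <- <- vE wE <- <- <- <- <- <-.
pose f1 (c : gcomp H) := (gincl c).1; pose f2 (c : gcomp H) := (gincl c).2.
pose P (c : gcomp H) : DD := (Phi (f1 c), Phi (f2 c)).
have mulE : ev2 (pullback f1 sigma) c v w + ev2 (pullback f2 sigma) c v w
    - ev2 (pullback (@gcompm _ H) sigma) c v w = ev2 (pullback P Omega) c v w.
  have E := congr1 (fun F : kform (gcomp H) 2 => F c (tnth [tuple v; w]))
    (lag_multiplicative lagr).
  exact: E.
have p1 := ev2_pullback f1 sigma c v w.
have p2 := ev2_pullback f2 sigma c v w.
have p3 := ev2_pullback (@gcompm _ H) sigma c v w.
have p4 := ev2_pullback P Omega c v w.
have p123 := congr2 (fun a b : R => a - b) (congr2 (fun a b : R => a + b) p1 p2) p3.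
have {}mulE := etrans (esym p123) (etrans mulE p4).
have gE : g = f1 c by rewrite /f1 cE.
have hE : h = f2 c by rewrite /f2 cE.
rewrite gE hE.
have d1 := comp1_mdifferentiable c; have d2 := comp2_mdifferentiable c.
have dP1 := mdifferentiable_comp d1 (Phi_mdifferentiable (f1 c)).
have dP2 := mdifferentiable_comp d2 (Phi_mdifferentiable (f2 c)).
have t1 z r q : tmap (@gincl _ H) c z = row_mx r q -> tmap f1 c z = r.
  by move=> zE; rewrite tmap_comp1 zE row_mxKl.
have t2 z r q : tmap (@gincl _ H) c z = row_mx r q -> tmap f2 c z = q.
  by move=> zE; rewrite tmap_comp2 zE row_mxKr.
have tP z r q : tmap (@gincl _ H) c z = row_mx r q ->
    tmap P c z = row_mx (tmap Phi (f1 c) r) (tmap Phi (f2 c) q).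
  move=> zE; apply: etrans (tmap_pair z dP1 dP2) _; apply: congr2.
    apply: etrans (tmap_comp z d1 (Phi_mdifferentiable (f1 c))) _.
    exact: congr1 (t1 _ _ _ zE).
  apply: etrans (tmap_comp z d2 (Phi_mdifferentiable (f2 c))) _.
  exact: congr1 (t2 _ _ _ zE).
have E1 := congr2 (ev2 sigma (f1 c)) (t1 _ _ _ vE) (t1 _ _ _ wE).
have E2 := congr2 (ev2 sigma (f2 c)) (t2 _ _ _ vE) (t2 _ _ _ wE).
have EP := congr2 (ev2 Omega (P c)) (tP _ _ _ vE) (tP _ _ _ wE).
have E12 := congr2 (fun a b : R => a + b) E1 E2.
have {}mulE := etrans mulE EP.
have {}E12 := etrans (esym (subKr _ _)) (congr2 (fun a b : R => a - b) E12 mulE).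
exact: E12.
Qed.

(** This differentiates the identity [Phi (gmul g h) = lmul (Phi g) (Phi h)] along [gcomp]. *)
Lemma tmap_Phi_gcompm (c : gcomp H) g h k a b v Z W A B :
  gincl c = (g, h) -> gmul g h = k -> Phi g = a -> Phi h = b ->
  tmap (@gincl _ H) c v = row_mx Z W ->
  tmap Phi g Z = A -> tmap Phi h W = B ->
  tmap Phi k (tmap (@gcompm _ H) c v) =
  tmap (fun k : DD => lmul k.1 k.2) (a, b) (row_mx A B).
Proof.
move=> cE <- <- <- vE <- <-.
pose f1 (c : gcomp H) := (gincl c).1; pose f2 (c : gcomp H) := (gincl c).2.
have gE : g = f1 c by rewrite /f1 cE.
have hE : h = f2 c by rewrite /f2 cE.
rewrite gE hE.
have d1 := comp1_mdifferentiable c; have d2 := comp2_mdifferentiable c.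
have dP1 := mdifferentiable_comp d1 (Phi_mdifferentiable (f1 c)).
have dP2 := mdifferentiable_comp d2 (Phi_mdifferentiable (f2 c)).
have t1 : tmap f1 c v = Z by rewrite tmap_comp1 vE row_mxKl.
have t2 : tmap f2 c v = W by rewrite tmap_comp2 vE row_mxKr.
have PE : (fun x => lmul (Phi (f1 x)) (Phi (f2 x))) = Phi \o (@gcompm _ H).
  apply/funext => x; rewrite /= (gmor_mul Phi_morph) //.
  have : range (@gincl _ H) (gincl x) by exists x.
  by rewrite gincl_range.
have Em := tmap_comp v (gcompm_mdifferentiable c) (Phi_mdifferentiable _).
have E1 := etrans (tmap_comp v d1 (Phi_mdifferentiable (f1 c)))
  (congr1 (tmap Phi (f1 c)) t1).
have E2 := etrans (tmap_comp v d2 (Phi_mdifferentiable (f2 c)))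
  (congr1 (tmap Phi (f2 c)) t2).
apply: etrans (esym Em) _; rewrite -PE.
apply: etrans (tmap_lmul_comp v dP1 dP2) _.
exact: (congr1 (tmap (fun k : DD => lmul k.1 k.2) (Phi (f1 c), Phi (f2 c)))
  (congr2 row_mx E1 E2)).
Qed.

Lemma gcomp_ex g h : gsrc H g = gtgt H h -> exists c : gcomp H, gincl c = (g, h).
Proof.
move=> gh; have : [set c | gsrc H c.1 = gtgt H c.2] (g, h) by [].
by rewrite -gincl_range => -[e _ ep]; exists e.
Qed.

(* [X'] is the product of [X] with the zero vector at [h]. *)
Lemma right_translation h (X : tH) u :
  tmap (gsrc H) (gunit H (gtgt H h)) X = 0 ->
  tmap Phi (gunit H (gtgt H h)) X = u ->
  exists2 X', tmap Phi h X' = rinv_field u (Phi h) &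
    forall W, ev2 sigma h X' W =
      ev2 sigma (gunit H (gtgt H h)) X
        (tmap (gunit H) (gtgt H h) (tmap (gtgt H) h W))
      - ev2 Omega (lone D, Phi h) (row_mx u 0) (row_mx 0 (tmap Phi h W)).
Proof.
move=> sX <-.
have XE := etrans sX (esym (tmap0 (gtgt H) h)).
have [c [v [cE vE]]] := composable_tangent (gsrc_unit _) XE.
have P1 := gmor_unit Phi_morph (gtgt H h).
exists (tmap (@gcompm _ H) c v).
  apply: etrans (tmap_Phi_gcompm cE (gmul_unitl h) P1 erefl vE erefl (tmap0 Phi h)) _.
  exact: tmap_lmul_l.
move=> W; have [w [wE wm]] := left_unit_tangent W cE.
(* The test vector [W] is written as the product of a vector tangent to the units with [W] itself.
   [Phi] kills the former, and the [sigma] term at [h] has the zero vector as an argument. *)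
apply: etrans (sigma_gcompm cE (gmul_unitl h) P1 erefl vE wE erefl wm
  erefl (tmap_Phi_gunit _ _) (tmap0 Phi h) erefl) _.
by rewrite (ev2_0l sigmaF) addr0.
Qed.

(** Mirror image of [right_translation]: the zero vector at [h] is multiplied on the right by [Y],
    which is composable with it because [Y] is tangent to a target fibre. *)
Lemma left_translation h (Y : tH) v :
  tmap (gtgt H) (gunit H (gsrc H h)) Y = 0 ->
  tmap Phi (gunit H (gsrc H h)) Y = v ->
  exists2 Y', tmap Phi h Y' = linv_field v (Phi h) &
    forall W, ev2 sigma h Y' W =
      ev2 sigma (gunit H (gsrc H h)) Y
        (tmap (gunit H) (gsrc H h) (tmap (gsrc H) h W))
      - ev2 Omega (Phi h, lone D) (row_mx 0 v) (row_mx (tmap Phi h W) 0).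
Proof.
move=> tY <-.
have YE := etrans (tmap0 (gsrc H) h) (esym tY).
have [c [z [cE zE]]] := composable_tangent (esym (gtgt_unit _)) YE.
have P1 := gmor_unit Phi_morph (gsrc H h).
exists (tmap (@gcompm _ H) c z).
  apply: etrans (tmap_Phi_gcompm cE (gmul_unitr h) erefl P1 zE (tmap0 Phi h) erefl) _.
  exact: tmap_lmul_r.
move=> W; have [w [wE wm]] := right_unit_tangent W cE.
apply: etrans (sigma_gcompm cE (gmul_unitr h) erefl P1 zE wE erefl wm
  (tmap0 Phi h) erefl erefl (tmap_Phi_gunit _ _)) _.
by rewrite (ev2_0l sigmaF) add0r.
Qed.

(* [right_translation] at a unit, where moreover [X' = X]. *)
Lemma sigma_at_unit x (X W : tH) u w :
  tmap (gsrc H) (gunit H x) X = 0 ->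
  tmap Phi (gunit H x) X = u -> tmap Phi (gunit H x) W = w ->
  ev2 sigma (gunit H x) X W =
  ev2 sigma (gunit H x) X (tmap (gunit H) x (tmap (gtgt H) (gunit H x) W))
  - ev2 Omega (lone D, lone D) (row_mx u 0) (row_mx 0 w).
Proof.
move=> sX <- <-.
have [c cE] := @gcomp_ex (gunit H x) (gunit H x) (etrans (gsrc_unit x) (esym (gtgt_unit x))).
have P1 := gmor_unit Phi_morph x.
have [v [vE vm]] : exists v, tmap (@gincl _ H) c v = row_mx X 0 /\
    tmap (@gcompm _ H) c v = X.
  have [|v] := @right_unit_tangent _ H c (gunit H x) X; first by rewrite gsrc_unit.
  by rewrite gsrc_unit sX (tmap0 (gunit H)) => vE; exists v.
have [z [wE wm]] : exists z, tmap (@gincl _ H) c z =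
    row_mx (tmap (gunit H) x (tmap (gtgt H) (gunit H x) W)) W /\
    tmap (@gcompm _ H) c z = W.
  have [|z] := @left_unit_tangent _ H c (gunit H x) W; first by rewrite gtgt_unit.
  by rewrite gtgt_unit => wE; exists z.
have uu : gmul (gunit H x) (gunit H x) = gunit H x.
  by have := gmul_unitl (gunit H x); rewrite gtgt_unit.
apply: etrans (sigma_gcompm cE uu P1 P1 vE wE vm wm
  erefl (tmap_Phi_gunit _ _) (tmap0 Phi _) erefl) _.
by rewrite (ev2_0l sigmaF) addr0.
Qed.

End Lagrangian.

(** * The Dirac structure of the Manin pair *)

Lemma rV_injective_surjective (R : fieldType) n (f : 'rV[R]_n -> 'rV[R]_n) :
  linear f -> (forall v, f v = 0 -> v = 0) -> forall w, exists v, f v = w.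
Proof.
move=> lf f0 w.
pose F : {linear 'rV[R]_n -> 'rV[R]_n} :=
  HB.pack f (GRing.isLinear.Build _ _ _ _ f lf).
have uF : lin1_mx F \in unitmx.
  rewrite -row_free_unit; apply: inj_row_free => v.
  by rewrite mul_rV_lin1; exact: f0.
exists (w *m invmx (lin1_mx F)).
by rewrite -[LHS]/(F _) -mul_rV_lin1 mulmxKV.
Qed.

Lemma lfun_of_linear (R : realType) (M : manifold R) (f : 'rV[R]_(mdim M) -> R) :
  (forall a u v, f (a *: u + v) = a * f u + f v) ->
  exists b : cotvec M, forall w, b w = f w.
Proof.
move=> lf.
have lf' : linear (f : _ -> R^o) by [].
pose F : {linear 'rV[R]_(mdim M) -> R^o} :=
  HB.pack (f : _ -> R^o) (GRing.isLinear.Build _ _ _ _ (f : _ -> R^o) lf').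
by exists (linfun F) => w; rewrite lfunE.
Qed.

Section Isometry.
Context {R : realType} (D : lie_group R).
Local Notation DD := (mprod D D).
Local Notation DDD := (mprod DD D).
Local Notation dd := 'rV[R]_(mdim D).
Variables (Omega : kform DD 2) (Theta : kform D 3).
Hypothesis symp : two_shifted_symplectic Omega Theta.

Let OmegaF := Omega_form symp.

Local Notation tm a b u v := (tmap (fun k : DD => lmul k.1 k.2) (a, b) (row_mx u v)).

(** The cocycle condition on [Omega], evaluated on two tangent vectors of the triple product;
    products again come as equations. The three identities that follow are specialisations of it. *)
Lemma delta_Omega_eval k1 k2 k3 k12 k23 u1 u2 u3 v1 v2 v3 u12 u23 v12 v23 :
  lmul k1 k2 = k12 -> lmul k2 k3 = k23 ->
  tm k1 k2 u1 u2 = u12 -> tm k1 k2 v1 v2 = v12 ->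
  tm k2 k3 u2 u3 = u23 -> tm k2 k3 v2 v3 = v23 ->
  ev2 Omega (k2, k3) (row_mx u2 u3) (row_mx v2 v3)
  - ev2 Omega (k12, k3) (row_mx u12 u3) (row_mx v12 v3)
  + ev2 Omega (k1, k23) (row_mx u1 u23) (row_mx v1 v23)
  - ev2 Omega (k1, k2) (row_mx u1 u2) (row_mx v1 v2) = 0.
Proof.
move=> <- <- <- <- <- <-.
pose p : DDD := ((k1, k2), k3).
pose P1 (k : DDD) : D := k.1.1; pose P2 (k : DDD) : D := k.1.2.
pose P3 (k : DDD) : D := k.2.
pose F1 (k : DDD) : DD := (P2 k, P3 k).
pose F2 (k : DDD) : DD := (lmul (P1 k) (P2 k), P3 k).
pose F3 (k : DDD) : DD := (P1 k, lmul (P2 k) (P3 k)).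
pose F4 (k : DDD) : DD := (P1 k, P2 k).
have [d1 t1] := @mdifferentiable_tmap_fst _ DD D p.
have [d3 t3] := @mdifferentiable_tmap_snd _ DD D p.
have [d11 t11] := @mdifferentiable_tmap_fst _ D D p.1.
have [d12 t12] := @mdifferentiable_tmap_snd _ D D p.1.
have dP1 : mdifferentiable P1 p := mdifferentiable_comp d1 d11.
have dP2 : mdifferentiable P2 p := mdifferentiable_comp d1 d12.
have dP3 : mdifferentiable P3 p := d3.
pose X u1 u2 u3 : 'rV[R]_(mdim DDD) :=
  row_mx (row_mx (u1 : dd) (u2 : dd) : 'rV[R]_(mdim DD)) (u3 : dd).
have T0 a b c : tmap (fst : DDD -> DD) p (X a b c) = row_mx a b.
  by rewrite t1; exact: row_mxKl.
have T1 a b c : tmap P1 p (X a b c) = a.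
  apply: etrans (tmap_comp _ d1 d11) _; apply: etrans (congr1 _ (T0 a b c)) _.
  by rewrite t11; exact: row_mxKl.
have T2 a b c : tmap P2 p (X a b c) = b.
  apply: etrans (tmap_comp _ d1 d12) _; apply: etrans (congr1 _ (T0 a b c)) _.
  by rewrite t12; exact: row_mxKr.
have T3 a b c : tmap P3 p (X a b c) = c by rewrite t3; exact: row_mxKr.
have dm12 : mdifferentiable (fun k => lmul (P1 k) (P2 k)) p :=
  mdifferentiable_comp (mdifferentiable_pair dP1 dP2) (lmul_mdifferentiable _).
have dm23 : mdifferentiable (fun k => lmul (P2 k) (P3 k)) p :=
  mdifferentiable_comp (mdifferentiable_pair dP2 dP3) (lmul_mdifferentiable _).
have Tm12 a b c : tmap (fun k => lmul (P1 k) (P2 k)) p (X a b c) = tm k1 k2 a b.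
  apply: etrans (tmap_lmul_comp (X a b c) dP1 dP2) _.
  exact: (congr1 (tmap (fun k : DD => lmul k.1 k.2) (k1, k2))
    (congr2 row_mx (T1 a b c) (T2 a b c))).
have Tm23 a b c : tmap (fun k => lmul (P2 k) (P3 k)) p (X a b c) = tm k2 k3 b c.
  apply: etrans (tmap_lmul_comp (X a b c) dP2 dP3) _.
  exact: (congr1 (tmap (fun k : DD => lmul k.1 k.2) (k2, k3))
    (congr2 row_mx (T2 a b c) (T3 a b c))).
have TF1 a b c : tmap F1 p (X a b c) = row_mx b c :=
  etrans (tmap_pair _ dP2 dP3) (congr2 row_mx (T2 a b c) (T3 a b c)).
have TF2 a b c : tmap F2 p (X a b c) = row_mx (tm k1 k2 a b) c :=
  etrans (tmap_pair _ dm12 dP3) (congr2 row_mx (Tm12 a b c) (T3 a b c)).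
have TF3 a b c : tmap F3 p (X a b c) = row_mx a (tm k2 k3 b c) :=
  etrans (tmap_pair _ dP1 dm23) (congr2 row_mx (T1 a b c) (Tm23 a b c)).
have TF4 a b c : tmap F4 p (X a b c) = row_mx a b :=
  etrans (tmap_pair _ dP1 dP2) (congr2 row_mx (T1 a b c) (T2 a b c)).
pose x := X u1 u2 u3; pose y := X v1 v2 v3.
have E1 := etrans (ev2_pullback F1 Omega p x y)
  (congr2 (ev2 Omega (F1 p)) (TF1 u1 u2 u3) (TF1 v1 v2 v3)).
have E2 := etrans (ev2_pullback F2 Omega p x y)
  (congr2 (ev2 Omega (F2 p)) (TF2 u1 u2 u3) (TF2 v1 v2 v3)).
have E3 := etrans (ev2_pullback F3 Omega p x y)
  (congr2 (ev2 Omega (F3 p)) (TF3 u1 u2 u3) (TF3 v1 v2 v3)).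
have E4 := etrans (ev2_pullback F4 Omega p x y)
  (congr2 (ev2 Omega (F4 p)) (TF4 u1 u2 u3) (TF4 v1 v2 v3)).
have closed0 : ev2 (pullback F1 Omega) p x y - ev2 (pullback F2 Omega) p x y
    + ev2 (pullback F3 Omega) p x y - ev2 (pullback F4 Omega) p x y = 0.
  have E := congr1 (fun F : kform DDD 2 => F p (tnth [tuple x; y])) (Omega_closed symp).
  exact: E.
apply: etrans closed0; apply: esym.
exact: (congr2 (fun a b : R => a - b) (congr2 (fun a b : R => a + b)
  (congr2 (fun a b : R => a - b) E1 E2) E3) E4).
Qed.

Lemma tm00 (a b : D) : tm a b 0 0 = 0.
Proof. by rewrite row_mx0; exact: tmap0. Qed.

Lemma tm11l u : tm (lone D) (lone D) u 0 = u.
Proof. exact: etrans (tmap_lmul_l _ _ _) (tmap_rtrans1 _ _). Qed.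

Lemma tm11r u : tm (lone D) (lone D) 0 u = u.
Proof. exact: etrans (tmap_lmul_r _ _ _) (tmap_ltrans1 _ _). Qed.

Lemma Omega_rr k u u' :
  ev2 Omega (lone D, k) (row_mx u 0) (row_mx 0 (rinv_field u' k)) +
  ev2 Omega (lone D, k) (row_mx u' 0) (row_mx 0 (rinv_field u k)) =
  - pairing Omega u u'.
Proof.
(* The cocycle condition at [(1, 1, k)] on [(a, 0, 0)] and [(0, b, 0)]. The term with both vectors
   in the first slot is antisymmetric in [a] and [b], so it disappears when the two halves are
   added. *)
have half a b : ev2 Omega (lone D, k) (row_mx a 0) (row_mx 0 (rinv_field b k)) =
    ev2 Omega (lone D, k) (row_mx a 0) (row_mx b 0) +
    ev2 Omega (lone D, lone D) (row_mx a 0) (row_mx 0 b).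
  have := delta_Omega_eval (lmul1l _) (lmul1l k) (tm11l a) (tm11r b) (tm00 _ _)
    (tmap_lmul_l _ _ b).
  by rewrite row_mx0 (ev2_0l OmegaF); lra.
rewrite !half /pairing.
rewrite (ev2C OmegaF (lone D, k) (row_mx u' 0) (row_mx u 0)).
rewrite (ev2C OmegaF (lone D, lone D) (row_mx 0 u) (row_mx u' 0)).
lra.
Qed.

Lemma Omega_ll k v v' :
  ev2 Omega (k, lone D) (row_mx (linv_field v k) 0) (row_mx 0 v') +
  ev2 Omega (k, lone D) (row_mx (linv_field v' k) 0) (row_mx 0 v) =
  - pairing Omega v v'.
Proof.
(* The cocycle condition at [(k, 1, 1)] on [(0, a, 0)] and [(0, 0, b)]. *)
have half a b : ev2 Omega (k, lone D) (row_mx (linv_field a k) 0) (row_mx 0 b) =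
    ev2 Omega (lone D, lone D) (row_mx a 0) (row_mx 0 b) +
    ev2 Omega (k, lone D) (row_mx 0 a) (row_mx 0 b).
  have := delta_Omega_eval (lmul1r k) (lmul1l _) (tmap_lmul_r _ _ a) (tm00 _ _)
    (tm11l a) (tm11r b).
  by rewrite row_mx0 (ev2_0r OmegaF); lra.
rewrite !half /pairing.
rewrite (ev2C OmegaF (k, lone D) (row_mx 0 v') (row_mx 0 v)).
rewrite (ev2C OmegaF (lone D, lone D) (row_mx 0 v) (row_mx v' 0)).
lra.
Qed.

Lemma Omega_rl k u v :
  ev2 Omega (k, lone D) (row_mx (rinv_field u k) 0) (row_mx 0 v) =
  ev2 Omega (lone D, k) (row_mx u 0) (row_mx 0 (linv_field v k)).
Proof.
(* The cocycle condition at [(1, k, 1)] on [(u, 0, 0)] and [(0, 0, v)], where two of the four terms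
   vanish. *)
have := delta_Omega_eval (lmul1l k) (lmul1r k) (tmap_lmul_l _ _ u) (tm00 _ _)
  (tm00 _ _) (tmap_lmul_r _ _ v).
by rewrite !row_mx0 (ev2_0r OmegaF) (ev2_0l OmegaF); lra.
Qed.

End Isometry.

(** * The isometry onto the generalised tangent space and its image of g + g *)

Section ActionDirac.
Context {R : realType} (D : lie_group R).
Local Notation DD := (mprod D D).
Local Notation dd := 'rV[R]_(mdim D).
Variables (Omega : kform DD 2) (Theta : kform D 3).
Hypothesis symp : two_shifted_symplectic Omega Theta.

Let OmegaF := Omega_form symp.

(** The vector part of the generators, here for all [u], [v] in the double and not only in [g],
    since the isometry argument needs the whole of d + d. *)
Definition action_field (k : D) (u v : dd) : dd := rinv_field u k - linv_field v k.

Definition action_covector (k : D) (u v w : dd) : R :=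
  ev2 Omega (lone D, k) (row_mx 0 w) (row_mx u 0)
  - ev2 Omega (k, lone D) (row_mx w 0) (row_mx 0 v).

Lemma row_mx_linear0 a (u v : dd) :
  row_mx (a *: u + v) (0 : dd) = a *: row_mx u (0 : dd) + row_mx v 0.
Proof. by rewrite scale_row_mx add_row_mx scaler0 addr0. Qed.

Lemma row_mx_0linear a (u v : dd) :
  row_mx (0 : dd) (a *: u + v) = a *: row_mx (0 : dd) u + row_mx 0 v.
Proof. by rewrite scale_row_mx add_row_mx scaler0 addr0. Qed.

Lemma action_field_linear k a u v u' v' :
  action_field k (a *: u + u') (a *: v + v') =
  a *: action_field k u v + action_field k u' v'.
Proof.
have r : rinv_field (a *: u + u') k = a *: rinv_field u k + rinv_field u' k.
  exact: linearP.
have l : linv_field (a *: v + v') k = a *: linv_field v k + linv_field v' k.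
  exact: linearP.
by rewrite /action_field r l scalerBr opprD addrACA.
Qed.

Lemma action_covector_linear k a u v u' v' w :
  action_covector k (a *: u + u') (a *: v + v') w =
  a * action_covector k u v w + action_covector k u' v' w.
Proof.
rewrite /action_covector row_mx_linear0 row_mx_0linear !(ev2_linearr OmegaF).
ring.
Qed.

Lemma action_covector_linearr k u v a w w' :
  action_covector k u v (a *: w + w') =
  a * action_covector k u v w + action_covector k u v w'.
Proof.
rewrite /action_covector row_mx_linear0 row_mx_0linear !(ev2_linearl OmegaF).
ring.
Qed.

Lemma action_covectorB k u v w w' :
  action_covector k u v (w - w') = action_covector k u v w - action_covector k u v w'.
Proof.
have := action_covector_linearr k u v (-1) w' w.
by rewrite scaleN1r mulN1r addrC => ->; rewrite addrC.
Qed.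

(** [Omega_rr] and [Omega_ll] supply the two pairings, and [Omega_rl] makes the mixed terms
    cancel. *)
Lemma action_isometry k u v u' v' :
  action_covector k u v (action_field k u' v') +
  action_covector k u' v' (action_field k u v) =
  pairing Omega u u' - pairing Omega v v'.
Proof.
have rr := Omega_rr symp k u u'; have ll := Omega_ll symp k v v'.
have rl := Omega_rl symp k u v'; have rl' := Omega_rl symp k u' v.
rewrite /action_field !action_covectorB /action_covector.
have sw a b : ev2 Omega (lone D, k) (row_mx 0 b) (row_mx a 0) =
    - ev2 Omega (lone D, k) (row_mx a 0) (row_mx 0 b) by exact: ev2C.
rewrite !sw.
lra.
Qed.

Lemma pairing0r u : pairing Omega u 0 = 0.
Proof. by rewrite /pairing row_mx0 !(ev2_0r OmegaF) oppr0 addr0. Qed.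

(** An isometry out of a nondegenerate space is injective: an element of its kernel is orthogonal to
    everything. *)
Lemma action_injective k u v :
  action_field k u v = 0 -> (forall w, action_covector k u v w = 0) ->
  u = 0 /\ v = 0.
Proof.
move=> f0 c0.
have c00 u' v' : action_covector k u' v' 0 = 0.
  by have := action_covectorB k u' v' 0 0; rewrite !subrr.
have iso u' v' : pairing Omega u u' - pairing Omega v v' = 0.
  by rewrite -(action_isometry k) c0 f0 c00 addr0.
split; apply: (pairing_nondegenerate symp) => w.
  by have := iso w 0; rewrite pairing0r subr0.
by have := iso 0 w; rewrite pairing0r sub0r => /eqP; rewrite oppr_eq0 => /eqP.
Qed.

Lemma action_surjective k (w0 : dd) (b : cotvec D) :
  exists u v, action_field k u v = w0 /\ forall w, action_covector k u v w = b w.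
Proof.
(* Covectors are recorded by their values on the standard basis, so the isometry becomes an
   endomorphism of a row space and injectivity gives surjectivity. *)
pose E (x : 'rV[R]_(mdim D + mdim D)) : 'rV[R]_(mdim D + mdim D) :=
  row_mx (action_field k (lsubmx x) (rsubmx x))
    (\row_i action_covector k (lsubmx x) (rsubmx x) (delta_mx 0 i)).
have coords u v (c : dd -> R) : (forall a w w', c (a *: w + w') = a * c w + c w') ->
    (forall i, action_covector k u v (delta_mx 0 i) = c (delta_mx 0 i)) ->
    forall w, action_covector k u v w = c w.
  move=> cl ce w.
  have [b1 b1E] := @lfun_of_linear R D _ (action_covector_linearr k u v).
  have [b2 b2E] := @lfun_of_linear R D _ cl.
  rewrite -b1E -b2E [w]row_sum_delta !linear_sum; apply: eq_bigr => i _.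
  by rewrite !linearZ /= b1E b2E ce.
have lE : linear E.
  move=> a x y; rewrite /E !linearP /= action_field_linear.
  rewrite scale_row_mx add_row_mx; congr row_mx.
  by apply/rowP => i; rewrite !mxE action_covector_linear.
have E0 x : E x = 0 -> x = 0.
  rewrite /E -[0 in RHS]row_mx0 => /eq_row_mx[f0 /rowP c0].
  have [|l0 r0] := action_injective f0.
    apply: coords => [a w w'|i]; first by rewrite mulr0 addr0.
    by have := c0 i; rewrite !mxE.
  by rewrite -[x]hsubmxK l0 r0 row_mx0.
have [x xE] := rV_injective_surjective lE E0 (row_mx w0 (\row_i b (delta_mx 0 i))).
have [fE /rowP cE] := eq_row_mx xE.
exists (lsubmx x), (rsubmx x); split=> //.
apply: coords => [a w w'|i]; first by rewrite linearP.
by have := cE i; rewrite !mxE.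
Qed.

Variables (q : quadratic_lie_algebra dd) (g : {vspace dd}).
Hypotheses (mp : manin_pair q g) (int : integrates Omega q).

(* [g + g] is its own orthogonal in [d + d], hence so is its isometric image. *)
Lemma action_dirac_maximal k (w0 : dd) (b : cotvec D) :
  (forall u v, u \in g -> v \in g ->
    b (action_field k u v) + action_covector k u v w0 = 0) ->
  action_dirac Omega g k (w0, b).
Proof.
move=> orth.
have [u [v [uv cv]]] := action_surjective k w0 b.
have iso u' v' : u' \in g -> v' \in g -> pairing Omega u u' - pairing Omega v v' = 0.
  by move=> u'g v'g; rewrite -(action_isometry k) uv cv orth.
have [_ perp] := mp.
exists u, v; split; [| |by rewrite -uv|by move=> w; rewrite -cv].
- apply/perp => v' v'g; rewrite -int.2.
  by have := iso v' 0 v'g (mem0v _); rewrite pairing0r subr0.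
- apply/perp => v' v'g; rewrite -int.2.
  have := iso 0 v' (mem0v _) v'g; rewrite pairing0r sub0r => /eqP.
  by rewrite oppr_eq0 => /eqP.
Qed.

(** Let [G] have a basis of [g] as rows and let [F] represent the form, which is invertible.
    Isotropy reads [G *m lin1_mx F *m G^T = 0], and a vanishing product bounds the sum of the two
    ranks, each equal to [\dim g]. *)
Lemma manin_dim : (2 * \dim g <= mdim D)%N.
Proof.
have qr a u v w : qform q w (a *: u + v) = a * qform q w u + qform q w v.
  by rewrite qform_sym qform_linear !(qform_sym _ w).
pose T u : 'rV[R]_(mdim D) := \row_j qform q u (delta_mx 0 j).
have lT : linear T.
  by move=> a u v; apply/rowP => j; rewrite !mxE qform_linear.
pose F : {linear 'rV[R]_(mdim D) -> 'rV[R]_(mdim D)} :=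
  HB.pack T (GRing.isLinear.Build _ _ _ _ T lT).
have TE u v : qform q u v = (T u *m v^T) 0 0.
  have [b bE] := @lfun_of_linear R D _ (fun a v w => qr a v w u).
  rewrite -bE {1}[v]row_sum_delta linear_sum mxE; apply: eq_bigr => j _.
  by rewrite linearZ /= bE !mxE mulrC.
have uF : lin1_mx F \in unitmx.
  rewrite -row_free_unit; apply: inj_row_free => v.
  rewrite mul_rV_lin1 => v0; apply: (qform_nondegenerate (q := q)) => w.
  by rewrite TE -[T v]/(F v) v0 mul0mx mxE.
pose G : 'M[R]_(\dim g, mdim D) := \matrix_i (vbasis g)`_i.
have fG : row_free G.
  apply: inj_row_free => z; rewrite mulmx_sum_row => z0; apply/rowP => i.
  have /freeP := basis_free (vbasisP g); rewrite mxE; apply.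
  by rewrite -[RHS]z0; apply: eq_bigr => j _; rewrite rowK.
have GFG : G *m lin1_mx F *m G^T = 0.
  apply/matrixP => i j; rewrite [RHS]mxE.
  have -> : (G *m lin1_mx F *m G^T) i j = qform q (row i G) (row j G).
    rewrite TE -[T _]/(F _) -mul_rV_lin1 -row_mul [LHS]mxE [RHS]mxE.
    by apply: eq_bigr => l _; rewrite !mxE.
  have [_ perp] := mp; rewrite !rowK.
  have memb (l : 'I_(\dim g)) : (vbasis g)`_l \in g.
    by apply: vbasis_mem; apply: mem_nth; rewrite size_tuple.
  by apply: (perp _).1; exact: memb.
have := mulmx0_rank_max GFG.
by rewrite mxrankMfree ?row_free_unit // mxrank_tr (eqP fG) mul2n addnn.
Qed.

End ActionDirac.

(** * Moment maps *)

Section MomentMap.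
Context {R : realType} (D : lie_group R).
Local Notation DD := (mprod D D).
Local Notation dd := 'rV[R]_(mdim D).
Variables (Omega : kform DD 2) (Theta : kform D 3).
Variables (q : quadratic_lie_algebra dd) (g : {vspace dd}).
Variables (H : lie_groupoid R) (Phi : garr H -> D) (sigma : kform (garr H) 2).
Hypotheses (mp : manin_pair q g) (symp : two_shifted_symplectic Omega Theta).
Hypotheses (int : integrates Omega q) (lagr : lagrangian_morphism Omega Theta Phi sigma).
Local Notation N := (gbase H).
Local Notation tH := 'rV[R]_(mdim (garr H)).
Local Notation tN := 'rV[R]_(mdim N).
Local Notation L := (corresponding_dirac Phi sigma).

Let OmegaF := Omega_form symp.
Let sigmaF := lag_form lagr.

(** This is lambda_sigma of [X], evaluated on [w]; membership of [X] in the Lie algebroid is kept as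
    a separate hypothesis. *)
Definition sigma_dual (x : N) (X : tH) (w : tN) : R :=
  ev2 sigma (gunit H x) X (tmap (gunit H) x w).

Lemma dirac_horizontal x (X : tH) :
  tmap (gsrc H) (gunit H x) X = 0 -> (forall w, sigma_dual x X w = 0) ->
  (L x `&` [set e | e.1.2 = 0])
    ((tmap (gtgt H) (gunit H x) X, 0 : cotvec N), tmap Phi (gunit H x) X).
Proof.
move=> sX lX; split=> //; exists X; split=> //= w.
by rewrite zero_lfunE; exact: (esym (lX w)).
Qed.

(* [- X + T eps (T t X)] is the image of [X] under the tangent map of the inversion. *)
Lemma flip_algebroid x (X : tH) : tmap (gsrc H) (gunit H x) X = 0 ->
  let Y := - X + tmap (gunit H) x (tmap (gtgt H) (gunit H x) X) in
  [/\ tmap (gtgt H) (gunit H x) Y = 0,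
      tmap Phi (gunit H x) Y = - tmap Phi (gunit H x) X &
      forall w, ev2 sigma (gunit H x) Y (tmap (gunit H) x w) = - sigma_dual x X w].
Proof.
move=> sX Y; split.
- by rewrite tmapD tmapN (tmap_gtgt_gunit x (tmap (gtgt H) (gunit H x) X)) addNr.
- by rewrite tmapD tmapN (tmap_Phi_gunit lagr x (tmap (gtgt H) (gunit H x) X)) addr0.
- move=> w; apply: etrans (ev2Dl sigmaF _ _ _ _) _.
  by rewrite (sigma_unit lagr) addr0 (ev2Nl sigmaF).
Qed.

Lemma ker_at_unit x (X : tH) :
  tmap (gsrc H) (gunit H x) X = 0 -> (forall w, sigma_dual x X w = 0) ->
  tmap Phi (gunit H x) X = 0 -> forall W, ev2 sigma (gunit H x) X W = 0.
Proof.
move=> sX lX PX W; apply: etrans (sigma_at_unit lagr sX PX erefl) _.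
rewrite row_mx0 (ev2_0l OmegaF) subr0; exact: lX.
Qed.

(** * From the fibrewise isomorphism to the strong Dirac morphism *)

Section FromDirac.
Hypothesis iso : fibrewise_iso L g.

Lemma lift_to_algebroid x u : u \in g ->
  exists X : tH, [/\ tmap (gsrc H) (gunit H x) X = 0,
    forall w, sigma_dual x X w = 0 & tmap Phi (gunit H x) X = u].
Proof.
move=> ug; have [_ _ /(_ u ug)[e [[X [sX _ lX PX]] e0] eu]] := iso x.
exists X; split=> //; last by rewrite -PX.
by move=> w; rewrite -[LHS]lX e0 zero_lfunE.
Qed.

(** Comparing the elements of L given by [X] and by 0, injectivity of the projection forces the
    anchor of [X] to vanish. Then [X] lies in all four kernels of the nondegeneracy condition at the
    unit. *)
Lemma Phi_algebroid_inj x (X : tH) :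
  tmap (gsrc H) (gunit H x) X = 0 -> (forall w, sigma_dual x X w = 0) ->
  tmap Phi (gunit H x) X = 0 -> X = 0.
Proof.
move=> sX lX PX; have [_ inj _] := iso x.
have sx0 := tmap0 (gsrc H) (gunit H x).
have l0 w : sigma_dual x 0 w = 0 by exact: ev2_0l.
have tX : tmap (gtgt H) (gunit H x) X = tmap (gtgt H) (gunit H x) 0.
  have := inj _ _ (mem_set (dirac_horizontal sX lX)) (mem_set (dirac_horizontal sx0 l0)).
  by move=> /(_ (etrans PX (esym (tmap0 Phi _))))[].
have : [set 0] X; last by [].
rewrite -(lag_nondegenerate lagr (gunit H x)); split; last first.
  by rewrite /ker_tmap /= tX; exact: tmap0.
by do 2!split=> //; exact: ker_at_unit.
Qed.

(** A dimension count shows that lambda_sigma maps the Lie algebroid onto the covectors: its kernel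
    embeds into [g] through [Phi], so has dimension at most half of [mdim D], while the algebroid
    has rank [mdim N] plus that half. *)
Lemma sigma_dual_nondegenerate x (w : tN) :
  (forall X, tmap (gsrc H) (gunit H x) X = 0 -> sigma_dual x X w = 0) -> w = 0.
Proof.
move=> w0.
have dimrV n : \dim {:'rV[R]_n} = n by rewrite dimvf dim_matrix; exact: mul1n.
pose S := linfun (tmap (gsrc H) (gunit H x)).
pose P := linfun (tmap Phi (gunit H x)).
pose l (X : tH) : tN := \row_j sigma_dual x X (delta_mx 0 j).
have ll : linear l.
  by move=> a u v; apply/rowP => j; rewrite !mxE /sigma_dual (ev2_linearl sigmaF).
pose l' : {linear tH -> tN} := HB.pack l (GRing.isLinear.Build _ _ _ _ l ll).
pose La := linfun l'.
have lE X v : sigma_dual x X v = \sum_j v 0 j * l X 0 j.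
  have [b bE] : exists b : cotvec N, forall v, b v = sigma_dual x X v.
    apply: lfun_of_linear => a u u'.
    apply: etrans (congr1 (ev2 sigma (gunit H x) X) (tmapP (gunit H) x a u u')) _.
    exact: ev2_linearr.
  rewrite -bE {1}[v]row_sum_delta linear_sum; apply: eq_bigr => j _.
  by rewrite linearZ /= bE mxE.
have memS X : (X \in lker S) = (tmap (gsrc H) (gunit H x) X == 0).
  by rewrite memv_ker lfunE.
have memLa X : (X \in lker La) = (l X == 0) by rewrite memv_ker lfunE.
have la0 X : X \in lker La -> forall v, sigma_dual x X v = 0.
  by rewrite memLa => /eqP X0 v; rewrite lE X0; apply: big1 => j _; rewrite mxE mulr0.
have dS : (\dim (lker S) + mdim N = mdim (garr H))%N.
  have := limg_ker_dim S fullv; rewrite capfv dimrV.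
  have -> : limg S = fullv.
    apply/eqP; rewrite eqEsubv; apply/andP; split; first exact: subvf.
    apply/subvP => v _; have [X XE] := (gsrc_submersion H).2 (gunit H x) v.
    by rewrite -XE -[tmap _ _ _]lfunE memv_img // memvf.
  by rewrite dimrV.
have dK : (\dim (lker S :&: lker La) <= \dim g)%N.
  have fg := set_bij_homo (iso x).
  rewrite -(limg_dim_eq (f := P)).
    apply: dimvS; apply/subvP => y /memv_imgP[X]; rewrite memv_cap => /andP[XS XL] ->.
    rewrite lfunE /=.
    move: XS; rewrite memS => /eqP XS.
    exact: (fg _ (dirac_horizontal XS (la0 _ XL))).
  apply/eqP; rewrite -subv0; apply/subvP => X; rewrite !memv_cap => /andP[/andP[XS XL]].
  rewrite memv_ker lfunE /= => /eqP XP; move: XS; rewrite memS => /eqP XS.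
  by rewrite (Phi_algebroid_inj XS (la0 _ XL) XP) mem0v.
have dLa := limg_ker_dim La (lker S).
have dg := manin_dim mp.
(* The dimension condition of [lag_dim], cleared of its denominator and subtraction so as to hold in
   the naturals. *)
have dims : (2 * mdim (garr H) = 4 * mdim N + mdim D)%N.
  apply/eqP; rewrite -(eqr_nat R) natrD !natrM.
  by have := lag_dim lagr; lra.
have full : (La @: lker S)%VS = fullv.
  apply/eqP; rewrite eqEdim subvf /= dimrV; lia.
apply/rowP => j; rewrite mxE.
(* An algebroid vector whose lambda_sigma is the [j]-th dual basis covector reads off the coordinate
   [w 0 j]. *)
have : delta_mx 0 j \in (La @: lker S)%VS by rewrite full memvf.
case/memv_imgP => X XS; rewrite lfunE /= => lX.
have := w0 X; rewrite lE -lX => /(_ _).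
rewrite (bigD1 j) //= big1 => [|k kj]; last by rewrite mxE (negPf kj) andbF mulr0.
rewrite mxE !eqxx mulr1 addr0; apply.
by move: XS; rewrite memS => /eqP.
Qed.

(** The preimage is the right translate of a lift of [u] plus the left translate of the flipped lift
    of [v]. The flip moves the lift from the source fibre to the target fibre and supplies the minus
    sign of [v] in the generator. *)
Lemma action_in_image h u v : u \in g -> v \in g ->
  exists Z, tmap Phi h Z = action_field (Phi h) u v /\
    forall W, ev2 sigma h Z W = action_covector Omega (Phi h) u v (tmap Phi h W).
Proof.
move=> ug vg.
have [X [sX lX PX]] := lift_to_algebroid (gtgt H h) ug.
have [Y [sY lY PY]] := lift_to_algebroid (gsrc H h) vg.
have [tY PY' lY'] := flip_algebroid sY.
have PY0 := etrans PY' (congr1 (fun z => - z) PY).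
have [X1 X1P X1s] := right_translation lagr sX PX.
have [Y1 Y1P Y1s] := left_translation lagr tY PY0.
have {}Y1P := etrans Y1P (tmapN _ _ _).
exists (X1 + Y1); split.
  exact: etrans (tmapD Phi h X1 Y1) (congr2 (fun a b => a + b) X1P Y1P).
move=> W.
have sX1 : ev2 sigma h X1 W =
    - ev2 Omega (lone D, Phi h) (row_mx u 0) (row_mx 0 (tmap Phi h W)).
  apply: etrans (X1s W) (etrans _ (sub0r _)); congr (_ - _); exact: lX.
have sY1 : ev2 sigma h Y1 W =
    - ev2 Omega (Phi h, lone D) (row_mx 0 (- v)) (row_mx (tmap Phi h W) 0).
  apply: etrans (Y1s W) (etrans _ (sub0r _)); congr (_ - _).
  by rewrite lY' lY oppr0.
rewrite (ev2Dl sigmaF) sX1 sY1 /action_covector; congr (_ + _).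
  by rewrite [RHS](ev2C OmegaF).
have -> : row_mx (0 : dd) (- v) = - row_mx 0 v by rewrite opp_row_mx oppr0.
by rewrite (ev2Nl OmegaF) opprK [LHS](ev2C OmegaF).
Qed.

Lemma dirac_strong : strong_dirac_morphism Phi sigma (action_dirac Omega g).
Proof.
move=> h; split.
  apply/seteqP; split=> [[w0 b] /= [u [v [ug vg /= w0E bE]]]|[w0 b] /= [Z [w0E bE]]].
    have [Z [PZ sZ]] := action_in_image h ug vg.
    exists Z; split; first by rewrite w0E PZ.
    by move=> w; rewrite sZ bE.
  (* Conversely, the forward image is isotropic because [sigma] is alternating, so its elements are
     orthogonal to the generators already found in it. *)
  apply: (action_dirac_maximal symp mp int) => u v ug vg.
  have [Z' [PZ' sZ']] := action_in_image h ug vg.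
  by rewrite -PZ' -bE w0E -sZ' (ev2C sigmaF) addNr.
apply/seteqP; split=> [Z [sZ PZ]|_ ->]; last first.
  by split; [move=> w; exact: ev2_0l | exact: tmap0].
have Omega0 p (r : 'rV[R]_(mdim DD)) (z : dd) : z = 0 ->
    ev2 Omega p r (row_mx 0 z) = 0 /\ ev2 Omega p r (row_mx z 0) = 0.
  by move=> ->; rewrite row_mx0; split; exact: ev2_0r.
have sZ' W : ev2 sigma h W Z = 0 by rewrite (ev2C sigmaF) sZ oppr0.
rewrite -(lag_nondegenerate lagr h); split; last first.
  (* Testing [Z] against right translates shows that every lambda_sigma of an algebroid vector kills
     [tmap (gtgt H) h Z]; left translates do the same for the source. *)
  apply: (@sigma_dual_nondegenerate (gtgt H h)) => X sX.
  have [X1 _ X1s] := right_translation lagr sX erefl.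
  have := etrans (esym (sZ' X1)) (X1s Z).
  by move=> /esym/eqP; rewrite subr_eq (Omega0 _ _ _ PZ).1 addr0 => /eqP.
split=> //.
apply: (@sigma_dual_nondegenerate (gsrc H h)) => X sX.
have [tY _ lY] := flip_algebroid sX.
have [Y1 _ Y1s] := left_translation lagr tY erefl.
have := etrans (esym (sZ' Y1)) (Y1s Z).
by move=> /esym/eqP; rewrite subr_eq (Omega0 _ _ _ PZ).2 addr0 lY oppr_eq0 => /eqP.
Qed.

End FromDirac.

(** * From the strong Dirac morphism to the fibrewise isomorphism *)

Section FromStrong.
Hypothesis strong : strong_dirac_morphism Phi sigma (action_dirac Omega g).

Lemma strong_iso : fibrewise_iso L g.
Proof.
move=> x.
have P1 : Phi (gunit H x) = lone D := gmor_unit (lag_morphism lagr) x.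
have [img ker0] := strong (gunit H x).
have beta u := lfun_of_linear (action_covector_linearr symp (lone D) u 0).
have field1 u v : action_field (lone D) u v = u - v.
  by rewrite /action_field rinv_field1 linv_field1.
split.
(* The projection lands in [g]: at the unit, [X] puts the generator with parameters [(xi, 0)] into
   the forward image. It therefore has parameters [u], [v] in [g] as well, and [action_injective]
   identifies [xi] with [u]. *)
- move=> [[a al] xi] /= [[X [sX /= aE lX xiE]] al0].
  have lX0 w : sigma_dual x X w = 0 by rewrite -[LHS]lX al0 zero_lfunE.
  have [b bE] := beta xi.
  have : action_dirac Omega g (Phi (gunit H x)) (xi, b).
    rewrite img /=; exists X; split=> // W; rewrite bE.
    apply: etrans (sigma_at_unit lagr sX (esym xiE) erefl) _.
    apply: etrans (congr2 (fun a b => a - b) (lX0 _) erefl) _.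
    rewrite sub0r /action_covector.
    by rewrite row_mx0 (ev2_0r OmegaF) subr0 [RHS](ev2C OmegaF).
  rewrite P1 => -[u [v [ug vg /= fE cE]]].
  have fld : action_field (lone D) (xi - u) (0 - v) = 0.
    rewrite field1 fE -[rinv_field u _ - _]/(action_field (lone D) u v) field1.
    by apply/rowP => j; rewrite !mxE; ring.
  have cov w : action_covector Omega (lone D) (xi - u) (0 - v) w = 0.
    have := action_covector_linear symp (lone D) (-1) u v xi 0 w.
    rewrite !scaleN1r [- u + xi]addrC addr0 sub0r => ->.
    by rewrite mulN1r -bE cE /action_covector addNr.
  by have [/eqP] := action_injective symp fld cov; rewrite subr_eq0 => /eqP ->.
(* Injectivity: the difference of two representatives lies in the kernels of [sigma] and of
   [tmap Phi], whose intersection is zero by strongness. *)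
- move=> [[a al] xi] [[a' al'] xi'] /set_mem[[X [sX /= aE lX PX]] /= al0].
  move=> /set_mem[[X' [sX' /= aE' lX' PX']] /= al0'] /= xiE.
  have lX0 w : sigma_dual x X w = 0 by rewrite -[LHS]lX al0 zero_lfunE.
  have lX0' w : sigma_dual x X' w = 0 by rewrite -[LHS]lX' al0' zero_lfunE.
  have subt (M : manifold R) (f : garr H -> M) c c' : tmap f (gunit H x) X = c ->
      tmap f (gunit H x) X' = c' -> tmap f (gunit H x) (X - X') = c - c'.
    by move=> <- <-; rewrite tmapD tmapN.
  have PY : tmap Phi (gunit H x) (X - X') = 0.
    by apply: etrans (subt _ _ _ _ (esym PX) (esym PX')) _; rewrite xiE subrr.
  have sY : tmap (gsrc H) (gunit H x) (X - X') = 0.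
    exact: etrans (subt _ _ _ _ sX sX') (subrr _).
  have lY w : sigma_dual x (X - X') w = 0.
    rewrite /sigma_dual (ev2Dl sigmaF) (ev2Nl sigmaF).
    exact: etrans (congr2 (fun a b => a - b) (lX0 w) (lX0' w)) (subrr _).
  have : [set 0] (X - X').
    by rewrite -ker0; split; [exact: ker_at_unit | exact: PY].
  by move=> /subr0_eq XX; rewrite aE aE' al0 al0' xiE XX.
- move=> u /= ug; have [b bE] := beta u.
  have : action_dirac Omega g (Phi (gunit H x)) (u, b).
    rewrite P1; exists u, 0; split; [exact: ug | exact: mem0v | |exact: bE].
    by have := field1 u 0; rewrite subr0.
  rewrite img => -[Z [/= uE sZ]].
  (* Surjectivity: subtracting the part of [Z] tangent to the units moves it into the source fibre
     without changing its image under [Phi]. On vectors tangent to the units, [sigma] against [Z] is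
     [b] of zero. *)
  pose X := Z - tmap (gunit H) x (tmap (gsrc H) (gunit H x) Z).
  have sX : tmap (gsrc H) (gunit H x) X = 0.
    apply: etrans (tmapD _ _ _ _) _.
    apply: etrans (congr1 (fun z => _ + z) (tmapN _ _ _)) _.
    by apply: etrans (congr1 (fun z => _ - z) (tmap_gsrc_gunit _ _)) _; exact: subrr.
  have PX : tmap Phi (gunit H x) X = u.
    apply: etrans (tmapD _ _ _ _) _.
    apply: etrans (congr1 (fun z => _ + z) (tmapN _ _ _)) _.
    apply: etrans (congr1 (fun z => _ - z) (tmap_Phi_gunit lagr _ _)) _.
    by rewrite subr0.
  have lX w : sigma_dual x X w = 0.
    rewrite /sigma_dual /X (ev2Dl sigmaF) (ev2Nl sigmaF) (sigma_unit lagr) subr0 sZ.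
    apply: etrans (congr1 b (tmap_Phi_gunit lagr x w)) _.
    exact: linear0.
  by exists ((tmap (gtgt H) (gunit H x) X, 0 : cotvec N), tmap Phi (gunit H x) X);
    [exact: dirac_horizontal | exact: PX].
Qed.

End FromStrong.
End MomentMap.

Theorem theorem5p3 (R : realType) (D : lie_group R)
    (Omega : kform (mprod D D) 2) (Theta : kform D 3)
    (d : quadratic_lie_algebra 'rV[R]_(mdim D)) (g : {vspace 'rV[R]_(mdim D)})
    (H : lie_groupoid R) (Phi : garr H -> D) (sigma : kform (garr H) 2) :
  manin_pair d g ->
  two_shifted_symplectic Omega Theta ->
  integrates Omega d ->
  lagrangian_morphism Omega Theta Phi sigma ->
  (fibrewise_iso (corresponding_dirac Phi sigma) g <->
   strong_dirac_morphism Phi sigma (action_dirac Omega g)) /\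
  (fibrewise_iso (corresponding_dirac Phi sigma) g <->
   multiplicative_moment_map Omega Theta g Phi sigma).
Proof.
move=> mp symp int lagr.
have equiv : fibrewise_iso (corresponding_dirac Phi sigma) g <->
    strong_dirac_morphism Phi sigma (action_dirac Omega g).
  by split; [exact: dirac_strong mp symp int lagr | exact: strong_iso symp lagr].
by split=> //; split=> [/equiv sd|[_ /equiv]].
Qed.
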